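(* For all integers $n\ge2$ and $k\ge0$, the map $\Phi$ restricts to a bijection between well-labelled Motzkin paths of size $n$ with $k$ horizontal steps and labelled binary trees with $n$ leaves exactly $k$ of which are single, and the map $\Psi$ restricts to a bijection between the latter trees and matchings on $[2n-2]$ having exactly $k$ pairs $\{i,j\}$ with $i\in\{1,\ldots,n\}$ and $j\in\{n+1,\ldots,2n-2\}$.
   Context: A well-labelled path of size $n$: $(\mathbf{p},\sigma)$ with $\mathbf{p}=p_1\ldots p_{n-1}$ a word on $\{-1,0,+1\}$, $\sigma$ a permutation of $[n]$, $p_i=-1\Rightarrow\sigma_i<\sigma_{i+1}$, $p_i=1\Rightarrow\sigma_i>\sigma_{i+1}$; Motzkin if $\sum_{i\le j}p_i\ge0$ for $j\le n-2$ and $\sum_{i\le n-1}p_i=-1$. A horizontal step is a letter $0$ of $\mathbf{p}$. A labelled binary tree of size $n$: rooted tree with $n$ leaves with distinct labels in $[n]$, unlabelled internal vertices each with exactly two unordered children. A leaf is single if its sibling is an internal vertex. A matching on $[2m]$ is a fixed-point-free involution. $\lambda_I$ is the order-preserving bijection $[|I|]\to I$; $\lambda(\tau)$ relabels the leaves of $\tau$ via $\lambda$. $\Phi$ (Motzkin paths of size $n\ge2$ to trees): $n=2$ gives a root with leaves $1,2$; for $n>2$, $p_1=0$: a root with subtrees a leaf $\sigma_1$ and $\lambda_{[n]\setminus\{\sigma_1\}}(\Phi(p_2\ldots p_{n-1},\sigma'))$ where $\sigma'_i=\lambda^{-1}_{[n]\setminus\{\sigma_1\}}(\sigma_{i+1})$;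 for $n>2$, $p_1=1$: with $k$ least such that $\sum_{i\le k}p_i=0$, a root with subtrees $\lambda_{I'}(\Phi(\mathbf{p}',\sigma'))$, $\lambda_{I''}(\Phi(\mathbf{p}'',\sigma''))$, where $I'=\{\sigma_1,\ldots,\sigma_k\}$, $I''=\{\sigma_{k+1},\ldots,\sigma_n\}$, $p'_i=-p_{k-i}$ ($i<k$), $p''_i=p_{k+i}$ ($i<n-k$), $\sigma'_i=\lambda^{-1}_{I'}(\sigma_{k+1-i})$, $\sigma''_i=\lambda^{-1}_{I''}(\sigma_{k+i})$. $\Psi$ (trees of size $n$ to matchings on $[2n-2]$): label the $n-2$ internal non-root vertices: while unlabelled non-root vertices remain, among those whose two children are both labelled pick the one having the child with least label, and give it the least unused label in $[2n-2]\setminus[n]$; then $\Psi(\tau)$ pairs $i$ and $j$ whenever they label siblings. *)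

(* Defs.v *)
From mathcomp Require Import all_boot all_order all_algebra.
Set Implicit Arguments. Unset Strict Implicit. Unset Printing Implicit Defensive.
Import GRing.Theory Num.Theory.

(* A path of size n is a pair (p, s): p = p_1 ... p_{n-1} a word on {-1,0,+1}
   (stored as a seq int, p_i = nth 0 p (i-1)), s = sigma_1 ... sigma_n a
   permutation of [n] = {1..n} (stored as a seq nat, sigma_i = nth 0 s (i-1)). *)

Definition psum (l : seq int) : int := (\sum_(x <- l) x)%R.

Definition is_letter (x : int) : bool := x \in [:: (-1)%R; 0%R; 1%R].

Definition well_labelled (n : nat) (p : seq int) (s : seq nat) : bool :=
  [&& size p == n.-1, size s == n, perm_eq s (iota 1 n), all is_letter p &
   all (fun i =>
          ((nth 0%R p i == (-1)%R) ==> (nth 0 s i < nth 0 s i.+1)) &&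
          ((nth 0%R p i == 1%R) ==> (nth 0 s i > nth 0 s i.+1)))
       (iota 0 (size p))].

Definition wl_motzkin (n : nat) (p : seq int) (s : seq nat) : bool :=
  [&& well_labelled n p s,
      all (fun j => (0%R <= psum (take j p))%R) (iota 0 n.-1) &
      psum p == (-1)%R].

Definition hsteps (p : seq int) : nat := count (fun x => x == 0%R) p.

Inductive btree := BLeaf of nat | BNode of btree & btree.

Fixpoint leaves (t : btree) : seq nat :=
  match t with BLeaf a => [:: a] | BNode l r => leaves l ++ leaves r end.

Fixpoint tmin (t : btree) : nat :=
  match t with BLeaf a => a | BNode l r => minn (tmin l) (tmin r) end.

(* Children are unordered: we represent an unordered tree by its canonical
   representative, in which the left child has the smaller least leaf label. *)
Fixpoint canonical (t : btree) : bool :=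
  match t with
  | BLeaf _ => true
  | BNode l r => [&& canonical l, canonical r & tmin l < tmin r]
  end.

Fixpoint norm (t : btree) : btree :=
  match t with
  | BLeaf a => BLeaf a
  | BNode l r =>
      let l' := norm l in let r' := norm r in
      if tmin l' <= tmin r' then BNode l' r' else BNode r' l'
  end.

Definition is_tree (n : nat) (t : btree) : bool :=
  canonical t && perm_eq (leaves t) (iota 1 n).

Definition is_leaf (t : btree) : bool := if t is BLeaf _ then true else false.

Fixpoint nsingle (t : btree) : nat :=
  match t with
  | BLeaf _ => 0
  | BNode l r =>
      (is_leaf l && ~~ is_leaf r) + (is_leaf r && ~~ is_leaf l)
      + nsingle l + nsingle r
  end.

Fixpoint relabel (f : nat -> nat) (t : btree) : btree :=
  match t with BLeaf a => BLeaf (f a) | BNode l r => BNode (relabel f l) (relabel f r) end.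

Definition lam (I : seq nat) (i : nat) : nat := nth 0 (sort leq I) i.-1.
Definition laminv (I : seq nat) (x : nat) : nat := (index x (sort leq I)).+1.

Fixpoint PhiF (fuel : nat) (p : seq int) (s : seq nat) : btree :=
  match fuel with
  | 0 => BLeaf 0
  | fuel'.+1 =>
    let n := size s in
    if n <= 2 then BNode (BLeaf 1) (BLeaf 2) else
    match p with
    | [::] => BLeaf 0
    | x :: p2 =>
      if x == 0%R then
        let s1 := head 0 s in
        let I := [seq y <- iota 1 n | y != s1] in
        BNode (BLeaf s1)
              (relabel (lam I) (PhiF fuel' p2 [seq laminv I y | y <- behead s]))
      else
        let k := (find (fun j => psum (take j.+1 p) == 0%R) (iota 0 (size p))).+1 in
        let I1 := take k s in
        let I2 := drop k s in
        let p1 := rev [seq (- y)%R | y <- take k.-1 p] in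
        let s1' := [seq laminv I1 y | y <- rev (take k s)] in
        let p2' := drop k p in
        let s2' := [seq laminv I2 y | y <- drop k s] in
        BNode (relabel (lam I1) (PhiF fuel' p1 s1'))
              (relabel (lam I2) (PhiF fuel' p2' s2'))
    end
  end.

(* Phi, with the output read as an unordered tree (canonical representative) *)
Definition Phi (p : seq int) (s : seq nat) : btree := norm (PhiF (size s) p s).

(* Iteratively: eligible vertices are exactly the "cherries" (nodes with two
   labelled children) once each labelled vertex is collapsed to a leaf. *)
Fixpoint cherries (t : btree) : seq (nat * nat) :=
  match t with
  | BLeaf _ => [::]
  | BNode l r =>
      if (l, r) is (BLeaf a, BLeaf b) then [:: (a, b)]
      else cherries l ++ cherries r
  end.

Definition pick_cherry (cs : seq (nat * nat)) : option (nat * nat) :=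
  foldr (fun c acc => match acc with
                      | None => Some c
                      | Some d => if minn c.1 c.2 < minn d.1 d.2 then Some c else Some d
                      end) None cs.

Fixpoint collapse (a b m : nat) (t : btree) : btree :=
  match t with
  | BLeaf x => BLeaf x
  | BNode l r =>
      if (l, r) is (BLeaf x, BLeaf y) then
        (if (x == a) && (y == b) then BLeaf m else t)
      else BNode (collapse a b m l) (collapse a b m r)
  end.

(* sibling pairs; m is the next unused label *)
Fixpoint psi_pairs (fuel m : nat) (t : btree) : seq (nat * nat) :=
  match fuel with
  | 0 => [::]
  | fuel'.+1 =>
    match t with
    | BLeaf _ => [::]
    | BNode (BLeaf a) (BLeaf b) => [:: (a, b)]
    | _ => match pick_cherry (cherries t) with
           | Some (a, b) => (a, b) :: psi_pairs fuel' m.+1 (collapse a b m t)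
           | None => [::]
           end
    end
  end.

Fixpoint partner (ps : seq (nat * nat)) (x : nat) : nat :=
  match ps with
  | [::] => x
  | (a, b) :: ps' => if x == a then b else if x == b then a else partner ps' x
  end.

(* A matching on [2n-2] is a fixed-point-free involution; we use 'I_(2n-2),
   where the ordinal i stands for the label i+1. *)
Definition is_matching (N : nat) (f : {ffun 'I_N -> 'I_N}) : bool :=
  [forall i, (f (f i) == i) && (f i != i)].

Definition Psi (n : nat) (t : btree) : {ffun 'I_(2 * n - 2) -> 'I_(2 * n - 2)} :=
  let ps := psi_pairs n n.+1 t in
  [ffun i => insubd i (partner ps (nat_of_ord i).+1).-1].

Definition cross (n : nat) (f : {ffun 'I_(2 * n - 2) -> 'I_(2 * n - 2)}) : nat :=
  #|[pred i : 'I_(2 * n - 2) | (i < n) && (n <= f i)]|.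

Definition bij_on (X Y : Type) (A : X -> bool) (B : Y -> bool) (f : X -> Y) : Prop :=
  [/\ forall x, A x -> B (f x),
      forall x y, A x -> A y -> f x = f y -> x = y &
      forall y, B y -> exists x, A x /\ f x = y].

(* Main.v *)
Require Import Defs.
From mathcomp Require Import all_boot all_order all_algebra zify.

(** For Phi, cutting a Motzkin path at its first return to height 0 is
    reversible: the two pieces are Motzkin paths on disjoint label sets whose
    first labels are compared by the down step at the cut, so an unordered pair
    of paths is recovered by sorting the first labels.  Horizontal steps
    correspond to single leaves at each stage.

    For Psi, each labelling step collapses the cherry {a, b} with the least
    label to a leaf with the new label m.  The pairs of the final matching that
    lie below m are exactly the cherries of the current tree, so {a, b} is read
    off the matching as its low pair with the least element, and the collapse
    is undone by expanding the leaf m.  A counting argument shows that a low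
    pair always exists, and single leaves are the leaves outside the cherries. *)

Set Implicit Arguments. Unset Strict Implicit. Unset Printing Implicit Defensive.
Import GRing.Theory Num.Theory Order.TTheory.
Implicit Types (p q : seq int) (s : seq nat) (t u : btree).

(** * Motzkin paths and Phi *)

Lemma psum_nil : psum [::] = 0%R.
Proof. exact: big_nil. Qed.

Lemma psum_cons x p : psum (x :: p) = (x + psum p)%R.
Proof. exact: big_cons. Qed.

Lemma psum_cat p q : psum (p ++ q) = (psum p + psum q)%R.
Proof. exact: big_cat. Qed.

Lemma psum_opp p : psum [seq (- y)%R | y <- p] = (- psum p)%R.
Proof. by rewrite /psum big_map raddf_sum. Qed.

Lemma psum_rev p : psum (rev p) = psum p.
Proof. by apply: perm_big; rewrite perm_rev. Qed.

Lemma psum_take_rev_opp p j :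
  psum (take j (rev [seq (- y)%R | y <- p])) = (psum (take (size p - j) p) - psum p)%R.
Proof.
rewrite take_rev size_map -map_drop psum_rev psum_opp.
by rewrite -[in X in (_ - X)%R](cat_take_drop (size p - j) p) psum_cat opprD addrA subrr add0r.
Qed.

(** * The labelling condition as a recursion on words *)

Definition step_ok (x : int) (a b : nat) : bool :=
  ((x == (-1)%R) ==> (a < b)) && ((x == 1%R) ==> (a > b)).

(** Recursive form of the indexed condition in [well_labelled], suited to induction on the word. The
    default of [head 0 s'] is harmless: when [s'] is empty the second conjunct is already false. *)
Fixpoint wl (p : seq int) (s : seq nat) : bool :=
  match p, s with
  | [::], [:: _] => true
  | x :: p', a :: s' => step_ok x a (head 0 s') && wl p' s'
  | _, _ => false
  end.

Lemma wl_all p s : size s = (size p).+1 ->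
  all (fun i =>
         ((nth 0%R p i == (-1)%R) ==> (nth 0 s i < nth 0 s i.+1)) &&
         ((nth 0%R p i == 1%R) ==> (nth 0 s i > nth 0 s i.+1)))
      (iota 0 (size p)) = wl p s.
Proof.
elim: p s => [|x p IH] [|a [|b s]] //= [sz].
rewrite -(IH (b :: s)) /=; last by rewrite sz.
by rewrite /step_ok -[1]/(1 + 0) iotaDl all_map; congr (_ && _).
Qed.

Lemma wl_cat p q x s a b s' : size s = size p ->
  wl (p ++ x :: q) (rcons s a ++ b :: s')
  = [&& wl p (rcons s a), step_ok x a b & wl q (b :: s')].
Proof.
elim: p s => [|y p IH] [|c s] //= [sz].
rewrite IH // -andbA; congr (step_ok _ _ _ && _).
by case: s {IH sz}.
Qed.

Lemma step_ok_opp x a b : step_ok (- x) b a = step_ok x a b.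
Proof. by rewrite /step_ok eqr_opp eqr_oppLR andbC. Qed.

(** Reversal exchanges the two neighbours of each letter, and negation exchanges ascents with
    descents; the two effects cancel by [step_ok_opp]. *)
Lemma wl_rev p s : size s = (size p).+1 ->
  wl (rev [seq (- y)%R | y <- p]) (rev s) = wl p s.
Proof.
elim: p s => [|x p IH] [|a [|b s]] //= [sz].
rewrite !rev_cons -!cats1 -IH /= ?sz // !cats1 -cats1 -[in LHS]cats1.
rewrite wl_cat ?size_rev ?size_map // step_ok_opp andbT andbC.
by rewrite rev_cons.
Qed.

(** * Motzkin words: joining and cutting *)

Definition mot (p : seq int) : bool :=
  all (fun j => (0%R <= psum (take j p))%R) (iota 0 (size p)) && (psum p == (-1)%R).

Lemma motP p :
  reflect ((forall j, j < size p -> (0 <= psum (take j p))%R) /\ psum p = (-1)%R)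
          (mot p).
Proof.
apply: (iffP andP) => -[pos tot]; split; try exact/eqP.
  by move=> j ltj; move/allP: pos; apply; rewrite mem_iota.
by apply/allP => j; rewrite mem_iota /= => /pos.
Qed.

(** The height reached is that of a proper prefix of [p], which is nonnegative, minus the total -1.
    This strict positivity is what puts the first return of a joined word exactly at the cut. *)
Lemma mot_rev_opp_gt0 p j : mot p -> 0 < j <= size p ->
  (0 < psum (take j (rev [seq (- y)%R | y <- p])))%R.
Proof.
move=> /motP[pos tot] /andP[j0 jp]; rewrite psum_take_rev_opp tot.
have /pos : size p - j < size p by lia.
lia.
Qed.

(** The reversed piece stays nonnegative and ends at height 1, the letter -1 brings the path back to
    0, and [p2] starts from there. *)
Lemma mot_join p1 p2 : mot p1 -> mot p2 ->
  mot (rev [seq (- y)%R | y <- p1] ++ (-1)%R :: p2).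
Proof.
move=> m1 /motP[pos2 tot2]; have /motP[pos1 tot1] := m1.
apply/motP; split; last first.
  by rewrite psum_cat psum_cons psum_rev psum_opp tot1 tot2.
move=> j; rewrite size_cat size_rev size_map /= => ltj.
rewrite take_cat size_rev size_map; case: ltnP => lej.
  case: (posnP j) => [->|j0]; first by rewrite take0 psum_nil.
  by apply: ltW; apply: mot_rev_opp_gt0 => //; lia.
rewrite psum_cat psum_rev psum_opp tot1.
case E: (j - size p1) => [|i] /=; first by rewrite psum_nil.
rewrite psum_cons; have /pos2 : i < size p2 by lia.
lia.
Qed.

Lemma letter_ge x : is_letter x -> (-1 <= x)%R.
Proof. by rewrite /is_letter !inE => /or3P[] /eqP->. Qed.

Lemma letter_opp x : is_letter (- x)%R = is_letter x.
Proof. by rewrite /is_letter !inE !eqr_oppLR opprK oppr0 orbCA orbA orbC orbCA. Qed.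

Lemma mot_cons0 p : mot (0%R :: p) = mot p.
Proof.
apply/motP/motP => -[pos tot]; split.
- by move=> j ltj; have := pos j.+1 ltj; rewrite /= psum_cons add0r.
- by move: tot; rewrite psum_cons add0r.
- by case=> [|j] ltj /=; rewrite ?psum_nil // psum_cons add0r; apply: pos.
- by rewrite psum_cons add0r.
Qed.

(* The cut is at the first return to height 0. *)
Lemma mot_split q : all is_letter q -> mot q -> psum (take 1 q) = 1%R ->
  exists p1 p2, [/\ mot p1, mot p2, all is_letter p1 && all is_letter p2 &
    q = rev [seq (- y)%R | y <- p1] ++ (-1)%R :: p2].
Proof.
move=> letq mq q1; have /motP[pos tot] := mq.
have sq : 1 < size q.
  rewrite ltnNge; apply/negP => le1.
  by move: q1; rewrite take_oversize // tot.
have step j : j < size q ->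
    (psum (take j.+1 q) = psum (take j q) + @nth int 0 q j)%R
    /\ (-1 <= @nth int 0 q j)%R.
  move=> ltj; rewrite (@take_nth int 0%R) // -cats1 psum_cat psum_cons psum_nil addr0.
  by split=> //; apply: letter_ge; apply: (allP letq); apply: mem_nth.
(* A return exists: the last letter is at least -1 and the total is -1, so the prefix without the
   last letter has height at most 0, hence exactly 0. *)
have exk : exists k, (0 < k < size q) && (psum (take k q) == 0%R).
  exists (size q).-1; have lt1 : (size q).-1 < size q by lia.
  have [] := step _ lt1; rewrite prednK ?take_size ?tot; last by lia.
  have := pos _ lt1; lia.
case: (ex_minnP exk) => k /andP[/andP[k0 kq] /eqP kz] kmin.
have gt0 j : 0 < j < k -> (0 < psum (take j q))%R.
  move=> /andP[j0 jk]; have jq : j < size q by lia.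
  have := pos j jq; have := kmin j; rewrite j0 jq /=.
  case: eqP => [_ /(_ isT)|nz _]; lia.
have k1 : 1 < k.
  by case: k k0 kz {kq kmin gt0} => [|[|k]] //; rewrite q1.
have ltk : k.-1 < size q by lia.
have [] := step _ ltk; rewrite prednK // kz => e1 e2.
have g1 : (0 < psum (take k.-1 q))%R by apply: gt0; lia.
(* One letter, at least -1, leads from a positive height to 0: the letter is -1 and the height
   before it is 1. *)
have ek : @nth int 0%R q k.-1 = (-1)%R by lia.
have e1' : psum (take k.-1 q) = 1%R by lia.
have eq_q : q = take k.-1 q ++ (-1)%R :: drop k q.
  by rewrite -{1}(cat_take_drop k.-1 q) (@drop_nth int 0%R) // ek prednK.
pose p1 : seq int := rev [seq (- y)%R | y <- take k.-1 q].
have rp1 : rev [seq (- y)%R | y <- p1] = take k.-1 q.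
  rewrite /p1 map_rev revK -map_comp map_id_in // => y _ /=; exact: opprK.
exists p1, (drop k q); split; last by rewrite rp1.
- apply/motP; split; last by rewrite psum_rev psum_opp e1'.
  have sz : size (take k.-1 q) = k.-1 by rewrite size_take ltk.
  rewrite size_rev size_map sz => j ltj.
  rewrite psum_take_rev_opp e1' sz take_takel ?leq_subr //.
  have /gt0 : 0 < k.-1 - j < k by lia.
  lia.
- apply/motP; split.
    move=> j; rewrite size_drop => ltj.
    have /pos : k + j < size q by lia.
    by rewrite takeD psum_cat kz add0r.
  by have := tot; rewrite -(cat_take_drop k q) psum_cat kz add0r cat_take_drop.
- apply/andP; split; last by apply/allP => x /mem_drop; apply: (allP letq).
  rewrite all_rev all_map; apply/allP => x /mem_take /= xq.
  by rewrite letter_opp; apply: (allP letq).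
Qed.

(** * Phi as a relation on words with arbitrary distinct labels *)

Definition gmot p s : bool :=
  [&& size s == (size p).+1, uniq s, all is_letter p, wl p s & mot p].

Lemma wl_motzkin_gmot n p s : 2 <= n ->
  wl_motzkin n p s = gmot p s && perm_eq s (iota 1 n).
Proof.
move=> n2; rewrite /wl_motzkin /well_labelled /gmot /mot.
case ps: (perm_eq s (iota 1 n)); last by rewrite !andbF.
have sz : size s = n by rewrite (perm_size ps) size_iota.
rewrite (perm_uniq ps) iota_uniq sz eqxx /= andbT.
have -> : (n == (size p).+1) = (size p == n.-1) by apply/eqP/eqP; lia.
case: eqP => //= szp; rewrite wl_all ?szp ?sz; last by lia.
by rewrite !andbA.
Qed.

(* The graph of Phi on words of arbitrary distinct labels, before the
   children are put in canonical order; no relabelling is then involved. *)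
Inductive PhiR : seq int -> seq nat -> btree -> Prop :=
| PhiR2 a b : a < b -> PhiR [:: (-1)%R] [:: a; b] (BNode (BLeaf a) (BLeaf b))
| PhiR0 (a : nat) p s t : a \notin s -> PhiR p s t ->
    PhiR (0%R :: p) (a :: s) (BNode (BLeaf a) t)
| PhiR1 p1 s1 t1 p2 s2 t2 : PhiR p1 s1 t1 -> PhiR p2 s2 t2 ->
    ~~ has (mem s1) s2 -> head 0 s1 < head 0 s2 ->
    PhiR (rev [seq (- y)%R | y <- p1] ++ (-1)%R :: p2) (rev s1 ++ s2) (BNode t1 t2).

(** In the cut case [rev s1] ends with the first label of [s1], so the comparison of heads in the
    rule is the label condition of the down step. *)
Lemma PhiR_gmot p s t : PhiR p s t -> gmot p s.
Proof.
elim=> {p s t} [a b ab | a p s t as' _ | p1 s1 t1 p2 s2 t2 _ g1 _ g2 dis hd].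
- rewrite /gmot /= inE /step_ok ab /mot /= psum_cons psum_nil !andbT.
  by rewrite neq_ltn ab.
- rewrite /gmot mot_cons0 /= as' /step_ok eqSS => /and5P[-> -> -> /= -> ->].
  by [].
- case/and5P: g1 => /eqP z1 u1 l1 w1 m1; case/and5P: g2 => /eqP z2 u2 l2 w2 m2.
  apply/and5P; split.
  + by rewrite !size_cat !size_rev size_map z1 z2 /= !addnS addSn.
  + rewrite cat_uniq rev_uniq u1 u2 andbT /=.
    by apply: contra dis => /hasP[x x2]; rewrite /= mem_rev => x1; apply/hasP; exists x.
  + rewrite all_cat all_rev all_map /= l2 !andbT.
    apply/allP=> x xp /=.
    by rewrite letter_opp (allP l1).
  + case: s1 z1 w1 hd {u1 dis} => [|a s1] // [z1] w1 hd.
    case: s2 z2 w2 hd {u2} => [|b s2] // [z2] w2 hd.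
    rewrite rev_cons wl_cat ?size_rev ?size_map // -rev_cons wl_rev /= ?z1 // w1 w2.
    by rewrite andbT /step_ok hd.
  + exact: mot_join.
Qed.

Lemma PhiR_leaves p s t : PhiR p s t -> perm_eq (leaves t) s.
Proof.
elim=> {p s t} //= [a p s t _ _ | p1 s1 t1 p2 s2 t2 _ h1 _ h2 _ _].
  by rewrite perm_cons.
by apply: perm_cat => //; rewrite perm_sym perm_rev perm_sym.
Qed.

Lemma PhiR_node p s t : PhiR p s t -> is_leaf t = false.
Proof. by case. Qed.

(** A letter 0 puts a leaf beside a tree that is never a leaf. The other two rules create no single
    leaf at the root, and negation preserves zero letters. *)
Lemma PhiR_hsteps p s t : PhiR p s t -> hsteps p = nsingle t.
Proof.
elim=> {p s t} //= [a p s t _ h IH | p1 s1 t1 p2 s2 t2 h1 IH1 h2 IH2 _ _].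
  by rewrite (PhiR_node h) -IH /hsteps /=; lia.
rewrite (PhiR_node h1) (PhiR_node h2) -IH1 -IH2 /hsteps count_cat count_rev count_map /=.
by rewrite !add0n; congr addn; apply: eq_count => x /=; rewrite oppr_eq0.
Qed.

(** Strong induction on the length. In a word of more than one letter the first letter is
    nonnegative; 0 is removed, and 1 leads to a cut by [mot_split]. *)
Lemma gmot_PhiR p s : gmot p s -> exists t, PhiR p s t.
Proof.
have [n] := ubnP (size p); elim: n p s => // n IH p s szn.
case/and5P=> /eqP z u l w m; case: p szn z l w m => [|x p] szn z l w m.
  by case/motP: m => _; rewrite psum_nil.
case: s z u w => [|a s] // [z] /= /andP[as' u] /andP[ok w].
have [lx lp] : is_letter x /\ all is_letter p by exact/andP.
have /motP[pos tot] := m.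
case: (posnP (size p)) => [p0|p0].
  case: s p z p0 as' ok tot {l w m lp pos IH szn u} => [|b [|c s]] // [] // _ _ _ ok tot.
  have xE : x = (-1)%R by move: tot; rewrite psum_cons psum_nil addr0.
  by move: ok; rewrite xE /step_ok /= andbT => ab; exists (BNode (BLeaf a) (BLeaf b)); constructor.
have x0 : (0 <= x)%R.
  by have := pos 1 p0; rewrite /= take0 psum_cons psum_nil addr0.
move: (lx); rewrite /is_letter !inE => /or3P[] /eqP xE; first by rewrite xE in x0.
  move: m; rewrite xE mot_cons0 => m.
  have [] := IH p s szn; first by rewrite /gmot z eqxx u lp w m.
  by move=> t Ht; exists (BNode (BLeaf a) t); constructor.
have [] := mot_split l m; first by rewrite /= take0 psum_cons psum_nil addr0 xE.
move=> p1 [p2 [m1 m2 /andP[l1 l2] E]].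
have sE : size (x :: p) = size p1 + (size p2).+1 by rewrite E size_cat size_rev size_map.
rewrite /= in sE.
have [lt1 lt2] : size p1 < n /\ size p2 < n by move: szn; rewrite /= sE; clear; lia.
(* A piece with [size p1] letters carries one more label; reversing it makes it start at the cut. *)
pose s1 := rev (take (size p1).+1 (a :: s)); pose s2 := drop (size p1).+1 (a :: s).
have sE' : a :: s = rev s1 ++ s2 by rewrite revK cat_take_drop.
have z1 : size s1 = (size p1).+1.
  by rewrite size_rev size_takel //= z; lia.
have z2 : size s2 = (size p2).+1 by rewrite size_drop /= z; lia.
have : uniq (a :: s) by rewrite /= as' u.
rewrite sE' cat_uniq rev_uniq => /and3P[u1 dis u2].
have : wl (x :: p) (a :: s) by rewrite /= ok w.
rewrite E sE'.

case: s1 z1 sE' u1 dis => [|c s1] // [z1] _ u1 dis.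
case: s2 z2 u2 dis => [|d s2] // [z2] u2 dis.
rewrite rev_cons wl_cat ?size_rev ?size_map // -rev_cons wl_rev /= ?z1 // => /and3P[w1 ok' w2].
have [||t1 h1] := IH p1 (c :: s1); first exact: lt1.
  by rewrite /gmot /= z1 eqxx l1 m1 -[_ && uniq _]/(uniq (c :: s1)) u1 w1.
have [||t2 h2] := IH p2 (d :: s2); first exact: lt2.
  by rewrite /gmot /= z2 eqxx l2 m2 -[_ && uniq _]/(uniq (d :: s2)) u2 w2.
exists (BNode t1 t2); apply: PhiR1 => //.
  by apply: contra dis => /hasP[y y2 y1]; apply/hasP; exists y => //=; rewrite mem_rev.
by move: ok'; rewrite /step_ok /= andbT.
Qed.

(** * Increasing relabellings *)

Lemma homo_ltn_inj (g : nat -> nat) s :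
  {in s &, {homo g : x y / x < y}} -> {in s &, injective g}.
Proof.
move=> mono x y xs ys E; case: (ltngtP x y) => // lt.
  by have := mono x y xs ys lt; rewrite E ltnn.
by have := mono y x ys xs lt; rewrite E ltnn.
Qed.

(** The rules only compare labels and ask for disjointness, and an increasing map respects both. *)
Lemma PhiR_relabel g p s t : {in s &, {homo g : x y / x < y}} ->
  PhiR p s t -> PhiR p [seq g x | x <- s] (relabel g t).
Proof.
move=> mono h.
elim: h mono => {p s t} [a b ab | a p s t as' h IH | p1 s1 t1 p2 s2 t2 h1 IH1 h2 IH2 dis hd] mono.
- by constructor; apply: mono => //; rewrite !inE eqxx ?orbT.
- have inj := homo_ltn_inj mono.
  constructor; last by apply: IH => x y xs ys; apply: mono; rewrite inE ?xs ?ys orbT.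
  apply: contra as' => /mapP[x xs E].
  by rewrite (inj a x) ?inE ?eqxx // xs orbT.
- have inj := homo_ltn_inj mono.
  have sub1 x : x \in s1 -> x \in rev s1 ++ s2 by rewrite mem_cat mem_rev => ->.
  have sub2 x : x \in s2 -> x \in rev s1 ++ s2 by rewrite mem_cat => ->; rewrite orbT.
  rewrite map_cat map_rev; constructor.
  + by apply: IH1 => x y xs ys; apply: mono; apply: sub1.
  + by apply: IH2 => x y xs ys; apply: mono; apply: sub2.
  + apply: contra dis => /hasP[x /mapP[y ys ->]] /mapP[z zs E].
    by apply/hasP; exists y => //=; rewrite (inj _ _ (sub2 _ ys) (sub1 _ zs) E).
  + case/and5P: (PhiR_gmot h1) => /eqP z1 _ _ _ _; case/and5P: (PhiR_gmot h2) => /eqP z2 _ _ _ _.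
    case: s1 s2 z1 z2 hd mono {h1 h2 IH1 IH2 dis inj sub1 sub2} => [|c s1] [|d s2] //= _ _ cd mono.
    by apply: mono; rewrite ?mem_cat ?mem_rev ?inE ?eqxx ?orbT.
Qed.

(** * Unordered trees through normal forms; injectivity and surjectivity of the relation *)

Lemma tmin_leaf t : tmin t \in leaves t.
Proof.
elim: t => [a|l IHl r IHr] /=; first by rewrite inE.
by rewrite mem_cat /minn; case: ifP; rewrite ?IHl ?IHr ?orbT.
Qed.

Lemma tmin_norm t : tmin (norm t) = tmin t.
Proof. by elim: t => //= l IHl r IHr; case: ifP => _ /=; rewrite IHl IHr // minnC. Qed.

Lemma leaves_norm t : perm_eq (leaves (norm t)) (leaves t).
Proof.
elim: t => //= l IHl r IHr; case: ifP => _ /=; last rewrite perm_catC;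
by apply: perm_cat.
Qed.

Lemma is_leaf_norm t : is_leaf (norm t) = is_leaf t.
Proof. by case: t => //= l r; case: ifP. Qed.

Lemma nsingle_norm t : nsingle (norm t) = nsingle t.
Proof.
by elim: t => //= l IHl r IHr; case: ifP => _ /=; rewrite !is_leaf_norm IHl IHr //; lia.
Qed.

(** [norm] compares with [<=] and [canonical] with [<]; distinct leaves make the two minima
    distinct, so the comparisons agree. *)
Lemma canonical_norm t : uniq (leaves t) -> canonical (norm t).
Proof.
elim: t => //= l IHl r IHr; rewrite cat_uniq => /and3P[ul dis ur].
have ne : tmin l != tmin r.
  apply: contra dis => /eqP E; apply/hasP; exists (tmin r); rewrite ?tmin_leaf //=.
  by rewrite -E tmin_leaf.
by rewrite !tmin_norm; case: ltngtP ne => //= lt _; rewrite IHl // IHr //= !tmin_norm.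
Qed.

Lemma norm_node_inj l r l' r' : norm (BNode l r) = norm (BNode l' r') ->
  norm l = norm l' /\ norm r = norm r' \/ norm l = norm r' /\ norm r = norm l'.
Proof. by move=> /=; case: ifP => _; case: ifP => _ [-> ->]; auto. Qed.

Lemma norm_leaf_inj a t : norm (BLeaf a) = norm t -> t = BLeaf a.
Proof. by case: t => [b|l r] /=; [case=> -> | case: ifP]. Qed.

(** The number of leaf children of the root determines the rule. Within a rule, exchanged children
    are impossible: the strict comparison of [a] and [b], or of the first labels recovered by
    induction, would hold both ways, and in the rule for 0 only one child is a leaf. *)
Lemma PhiR_inj p s t p' s' t' : PhiR p s t -> PhiR p' s' t' -> norm t = norm t' ->
  p = p' /\ s = s'.
Proof.
move=> h; elim: h p' s' t' => {p s t}
  [a b ab | a p s t _ h IH | p1 s1 t1 p2 s2 t2 h1 IH1 h2 IH2 _ hd] p' s' t' h';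
  case: h' => {p' s' t'}
  [a' b' ab' | a' p' s' t' _ h' | p1' s1' t1' p2' s2' t2' h1' h2' _ hd'].
- move=> /norm_node_inj[] [/norm_leaf_inj[E1] /norm_leaf_inj[E2]]; first by rewrite E1 E2.
  by move: ab ab'; rewrite E1 E2 => /ltn_trans/[apply]; rewrite ltnn.
- move=> /norm_node_inj[] [/norm_leaf_inj E1 /norm_leaf_inj E2].
    by have := PhiR_node h'; rewrite E2.
  by have := PhiR_node h'; rewrite E1.
- move=> /norm_node_inj[] [/norm_leaf_inj E1 /norm_leaf_inj E2].
    by have := PhiR_node h1'; rewrite E1.
  by have := PhiR_node h1'; rewrite E2.
- move=> /esym/norm_node_inj[] [/norm_leaf_inj E1 /norm_leaf_inj E2].
    by have := PhiR_node h; rewrite E2.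
  by have := PhiR_node h; rewrite E1.
- move=> /norm_node_inj[] [/norm_leaf_inj E1 E2].
    by case: E1 => ->; have [-> ->] := IH _ _ _ h' E2.
  by have := PhiR_node h'; rewrite E1.
- move=> /norm_node_inj[] [/norm_leaf_inj E1 _].
    by have := PhiR_node h1'; rewrite E1.
  by have := PhiR_node h2'; rewrite E1.
- move=> /esym/norm_node_inj[] [/norm_leaf_inj E1 _].
    by have := PhiR_node h1; rewrite E1.
  by have := PhiR_node h2; rewrite E1.
- move=> /esym/norm_node_inj[] [/norm_leaf_inj E1 _].
    by have := PhiR_node h1; rewrite E1.
  by have := PhiR_node h2; rewrite E1.
- move=> /norm_node_inj[] [E1 E2].
    by have [-> ->] := IH1 _ _ _ h1' E1; have [-> ->] := IH2 _ _ _ h2' E2.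
  have [_ e1] := IH1 _ _ _ h2' E1; have [_ e2] := IH2 _ _ _ h1' E2.
  by move: hd hd'; rewrite e1 e2 => /ltn_trans/[apply]; rewrite ltnn.
Qed.

Lemma PhiR_surj t : canonical t -> uniq (leaves t) -> is_leaf t = false ->
  exists p s t', PhiR p s t' /\ norm t' = t.
Proof.
elim: t => // l IHl r IHr /= /and3P[cl cr lt]; rewrite cat_uniq => /and3P[ul dis ur] _.
case: l cl lt ul dis IHl => [a|ll lr] cl lt ul dis IHl;
  case: r cr lt ur dis IHr => [b|rl rr] cr lt ur dis IHr.
- by exists [:: (-1)%R], [:: a; b], (BNode (BLeaf a) (BLeaf b)); split;
    [constructor | rewrite /= ltnW].
- have [p [s [t [h E]]]] := IHr cr ur erefl.
  exists (0%R :: p), (a :: s), (BNode (BLeaf a) t); split; last first.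
    by move: lt; rewrite /= E => /= /ltnW->.
  constructor=> //; apply: contra dis => as'.
  apply/hasP; exists a; last by rewrite /= inE.
  by rewrite -E
     (perm_mem (leaves_norm t)) (perm_mem (PhiR_leaves h)).
- have [p [s [t [h E]]]] := IHl cl ul erefl.
  exists (0%R :: p), (b :: s), (BNode (BLeaf b) t); split; last first.
    by rewrite /= E leqNgt lt.
  constructor=> //; apply: contra dis => bs.
  apply/hasP; exists b; rewrite ?inE //; apply/idP.
  by change (b \in leaves (BNode ll lr)); rewrite -E
     (perm_mem (leaves_norm t)) (perm_mem (PhiR_leaves h)).
- have [p1 [s1 [t1 [h1 E1]]]] := IHl cl ul erefl.
  have [p2 [s2 [t2 [h2 E2]]]] := IHr cr ur erefl.
  have mem1 x : x \in s1 -> x \in leaves (BNode ll lr).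
    by rewrite -E1 (perm_mem (leaves_norm t1)) (perm_mem (PhiR_leaves h1)).
  have mem2 x : x \in s2 -> x \in leaves (BNode rl rr).
    by rewrite -E2 (perm_mem (leaves_norm t2)) (perm_mem (PhiR_leaves h2)).
  have hd0 p s t : PhiR p s t -> head 0 s \in s.
    by case/PhiR_gmot/and5P; case: s => //= c s; rewrite inE eqxx.
  have ne : head 0 s1 != head 0 s2.
    apply: contra dis => /eqP E; apply/hasP; exists (head 0 s2).
      exact/mem2/(hd0 _ _ _ h2).
    by rewrite -E; apply/mem1/(hd0 _ _ _ h1).
  (* The pieces are ordered by their first labels, the children of [t] by their least labels. The
     two orders may differ, and [norm] absorbs the exchange. *)
  case: ltngtP ne => // hd _.
    exists (rev [seq (- y)%R | y <- p1] ++ (-1)%R :: p2), (rev s1 ++ s2), (BNode t1 t2).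
    split; last by move: lt; rewrite -E1 -E2 => /ltnW /= ->.
    constructor=> //; apply: contra dis => /hasP[x /mem2 x2 /mem1 x1].
    by apply/hasP; exists x.
  exists (rev [seq (- y)%R | y <- p2] ++ (-1)%R :: p1), (rev s2 ++ s1), (BNode t2 t1).
  split; last by move: lt; rewrite -E1 -E2 ltnNge /= => /negbTE->.
  constructor=> //; apply: contra dis => /hasP[x /mem1 x1 /mem2 x2].
  by apply/hasP; exists x.
Qed.

(** * The recursive function agrees with the relation *)

Lemma lam_laminv (I : seq nat) x : x \in I -> lam I (laminv I x) = x.
Proof. by move=> xI; rewrite /lam /laminv /= nth_index // mem_sort. Qed.

Lemma laminv_homo (I : seq nat) : {in I &, {homo laminv I : x y / x < y}}.
Proof.
move=> x y xI yI xy; rewrite /laminv ltnS ltnNge; apply: contraL xy => le.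
rewrite -leqNgt -[y](@nth_index _ 0 y (sort leq I)) ?mem_sort //.
rewrite -[X in _ <= X](@nth_index _ 0 x (sort leq I)) ?mem_sort //.
apply: (sorted_leq_nth leq_trans leqnn) => //.
- exact/sort_sorted/leq_total.
- by rewrite inE index_mem mem_sort.
- by rewrite inE index_mem mem_sort.
Qed.

Lemma perm_laminv (I : seq nat) s : uniq I -> perm_eq s I ->
  perm_eq [seq laminv I x | x <- s] (iota 1 (size s)).
Proof.
move=> uI sI; have sI' : perm_eq s (sort leq I) by rewrite (perm_trans sI) // perm_sym perm_sort.
rewrite (perm_trans (perm_map _ sI')) // (perm_size sI').
set S := sort leq I; rewrite [X in perm_eq X _](_ : _ = iota 1 (size S)) //.
apply: (@eq_from_nth _ 0) => [|i]; rewrite size_map ?size_iota // => iS.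
by rewrite (nth_map 0) // nth_iota // /laminv index_uniq // sort_uniq.
Qed.

Lemma relabel_id_in g t : {in leaves t, forall x, g x = x} -> relabel g t = t.
Proof.
elim: t => [a|l IHl r IHr] /= gid; first by rewrite gid ?inE.
by rewrite IHl ?IHr // => x xs; apply: gid; rewrite mem_cat xs ?orbT.
Qed.

Lemma relabel_comp g h t : relabel g (relabel h t) = relabel (g \o h) t.
Proof. by elim: t => //= l -> r ->. Qed.

Lemma find_iota0 (P : pred nat) k n : k < n -> P k -> (forall j, j < k -> ~~ P j) ->
  find P (iota 0 n) = k.
Proof.
move=> kn Pk nP; rewrite -(subnKC (ltnW kn)) iotaD find_cat size_iota.
have -> : has P (iota 0 k) = false.
  by apply/hasP => -[j]; rewrite mem_iota /= => /nP/negbTE->.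
have -> : n - k = (n - k).-1.+1 by lia.
by rewrite /= add0n Pk addn0.
Qed.

(** One unfolding of the cut case. Here [k] is the zero-based result of [find], so the first return
    occurs after [k.+1] letters, and [take k p] is the part before the down step. *)
Lemma PhiF_cut f p s k : 2 < size s -> head 0%R p != 0%R ->
  find (fun j => psum (take j.+1 p) == 0%R) (iota 0 (size p)) = k ->
  PhiF f.+1 p s =
  BNode (relabel (lam (take k.+1 s))
           (PhiF f (rev [seq (- y)%R | y <- take k p])
                   [seq laminv (take k.+1 s) y | y <- rev (take k.+1 s)]))
        (relabel (lam (drop k.+1 s))
           (PhiF f (drop k.+1 p) [seq laminv (drop k.+1 s) y | y <- drop k.+1 s])).
Proof.
case: p => [|x p]; first by rewrite eqxx.
rewrite ltnNge => /negbTE szs /negbTE nz <-.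
by rewrite {1}/PhiF -/PhiF szs -[x]/(head 0%R (x :: p)) nz.
Qed.

(** Induction on the fuel, which suffices because both pieces have fewer labels than the whole. *)
Lemma PhiR_PhiF f p s t : PhiR p s t -> size s <= f -> perm_eq s (iota 1 (size s)) ->
  PhiF f p s = t.
Proof.
elim: f p s t => [|f IH] p s t h szf ps.
  by have := PhiR_gmot h; case/and5P; move: szf; case: (s).
(* A recursive call works on labels standardised by [laminv]. By [PhiR_relabel] it returns the
   [laminv] image of [t0], and [lam] undoes it. *)
have sub p0 s0 t0 I : PhiR p0 s0 t0 -> size s0 <= f -> perm_eq s0 I ->
    relabel (lam I) (PhiF f p0 [seq laminv I x | x <- s0]) = t0.
  move=> h0 sz0 ps0; have /and5P[_ u0 _ _ _] := PhiR_gmot h0.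
  have uI : uniq I by rewrite -(perm_uniq ps0).
  rewrite (IH _ _ (relabel (laminv I) t0)).
  - rewrite relabel_comp relabel_id_in // => x xt /=; rewrite lam_laminv //.
    by rewrite -(perm_mem ps0) -(perm_mem (PhiR_leaves h0)).
  - apply: PhiR_relabel => // x y; rewrite !(perm_mem ps0); exact: laminv_homo.
  - by rewrite size_map.
  - by rewrite size_map; apply: perm_laminv.
case: h szf ps => {p s t} [a b ab | a p s t as' h | p1 s1 t1 p2 s2 t2 h1 h2 dis hd] szf ps.
- have : (a \in iota 1 2) && (b \in iota 1 2) by rewrite -!(perm_mem ps) !inE !eqxx orbT.
  by rewrite !mem_iota => ?; have [-> ->] : a = 1 /\ b = 2 by lia.
- have szs : 1 < size s.
    have /and5P[/eqP-> _ _ _ /motP[_]] := PhiR_gmot h.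
    by case: (p) => //; rewrite psum_nil.
  rewrite /= ltnS leqNgt szs /= (sub _ _ _ _ h) //.
  have sE : [seq y <- a :: s | y != a] = s.
    rewrite /= eqxx /=; apply/all_filterP/allP => y ys.
    by apply: contraNneq as' => <-.
  by rewrite -{1}sE; apply: (perm_filter (fun y => y != a) ps).
- have /and5P[/eqP z1 u1 _ _ m1] := PhiR_gmot h1.
  have /and5P[/eqP z2 u2 _ _ m2] := PhiR_gmot h2.
  have p10 : 0 < size p1.
    by have /motP[_] := m1; case: (p1) => //; rewrite psum_nil.
  have p20 : 0 < size p2.
    by have /motP[_] := m2; case: (p2) => //; rewrite psum_nil.
  move: szf; rewrite size_cat size_rev => szf.
  set P := rev [seq (- y)%R | y <- p1] in ps *.
  have szP : size P = size p1 by rewrite size_rev size_map.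
  (* The nonempty prefixes of [P] have positive height, and [P] ends at height 1, so the next letter
     gives the first return. *)
  have findE : find (fun j => psum (take j.+1 (P ++ (-1)%R :: p2)) == 0%R)
      (iota 0 (size (P ++ (-1)%R :: p2))) = size p1.
    apply: find_iota0; first by rewrite size_cat szP /=; lia.
      rewrite take_cat szP ltnNge leqnSn /= subSnn /= take0 psum_cat psum_cons psum_nil.
      by rewrite psum_rev psum_opp; have /motP[_ ->] := m1.
    move=> j jp; rewrite take_cat szP; case: ltnP => [lt|ge].
      by rewrite gt_eqF //; apply: mot_rev_opp_gt0 => //; lia.
    have -> : j.+1 - size p1 = 0 by lia.
    rewrite take0 cats0 -[P]take_size szP.
    by rewrite gt_eqF //; apply: mot_rev_opp_gt0 => //; lia.
  have P1 : (0 < psum (take 1 P))%R by apply: mot_rev_opp_gt0.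
  have nz : head 0%R (P ++ (-1)%R :: p2) != 0%R.
    move: P1; case: (P) szP p10 => [<-|x q] //=.
    by rewrite take0 psum_cons psum_nil addr0 => _ _ /gt_eqF->.
  rewrite (PhiF_cut _ _ nz findE); last by rewrite size_cat size_rev z1 z2; lia.
  rewrite -[P ++ _ :: _]cat_rcons [drop _ (rcons _ _ ++ _)]drop_size_cat ?size_rcons ?szP //.
  rewrite cat_rcons [take _ (P ++ _)]take_size_cat //.
  rewrite take_size_cat ?drop_size_cat ?size_rev // revK.
  rewrite /P map_rev revK -map_comp map_id_in; last by move=> y _ /=; rewrite opprK.
  rewrite (sub _ _ _ _ h1) ?(sub _ _ _ _ h2) //; try lia.
  by rewrite perm_sym perm_rev.
Qed.

Theorem Phi_bij n k : 2 <= n ->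
  bij_on (fun x : seq int * seq nat => wl_motzkin n x.1 x.2 && (hsteps x.1 == k))
         (fun t => is_tree n t && (nsingle t == k))
         (fun x => Phi x.1 x.2).
Proof.
move=> n2.
have graph p s : wl_motzkin n p s -> exists t, PhiR p s t /\ Phi p s = norm t.
  rewrite wl_motzkin_gmot // => /andP[/gmot_PhiR[t h] ps]; exists t; split=> //.
  by rewrite /Phi (PhiR_PhiF h) // (perm_size ps) size_iota.
split.
- case=> p s /= /andP[wlm /eqP <-]; have [t [h ->]] := graph _ _ wlm.
  rewrite nsingle_norm (PhiR_hsteps h) eqxx andbT /is_tree.
  move: wlm; rewrite wl_motzkin_gmot // => /andP[/and5P[_ u _ _ _] ps].
  rewrite canonical_norm ?(perm_uniq (PhiR_leaves h)) //=.
  exact/(perm_trans (leaves_norm _))/(perm_trans (PhiR_leaves h)).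
- case=> p s [p' s'] /= /andP[wlm _] /andP[wlm' _].
  have [t [h ->]] := graph _ _ wlm; have [t' [h' ->]] := graph _ _ wlm'.
  by case/(PhiR_inj h h') => -> ->.
- move=> t /andP[/andP[ct pt] /eqP <-].
  have [p [s [t' [h E]]]] : exists p s t', PhiR p s t' /\ norm t' = t.
    apply: PhiR_surj => //; first by rewrite (perm_uniq pt) iota_uniq.
    by case: (t) (perm_size pt) => // a; rewrite size_iota => /= En; rewrite -En in n2.
  have wlm : wl_motzkin n p s.
    rewrite wl_motzkin_gmot // (PhiR_gmot h) /=; apply: perm_trans pt; rewrite -E.
    by rewrite perm_sym (perm_trans (leaves_norm t')) // (PhiR_leaves h).
  exists (p, s); split; first by rewrite /= wlm (PhiR_hsteps h) -E nsingle_norm eqxx.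
  move: wlm; rewrite wl_motzkin_gmot // => /andP[_ ps].
  by rewrite /Phi /= (PhiR_PhiF h) // (perm_size ps) size_iota.
Qed.

(** * Matchings and Psi *)

(** [uniq (flat ps)] says that [ps] is a matching of its entries: the pairs are disjoint and none
    has equal components. *)
Fixpoint flat (ps : seq (nat * nat)) : seq nat :=
  if ps is c :: ps' then [:: c.1, c.2 & flat ps'] else [::].

(** Two lists describe the same matching when their [haspair] relations coincide, whatever the order
    of the list or the orientation of the pairs. *)
Definition haspair (ps : seq (nat * nat)) (x y : nat) : bool :=
  ((x, y) \in ps) || ((y, x) \in ps).

Implicit Types ps cs : seq (nat * nat).

Lemma haspairC ps x y : haspair ps x y = haspair ps y x.
Proof. exact: orbC. Qed.

Lemma haspair_cons a b ps x y : haspair ((a, b) :: ps) x y =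
  [|| (x == a) && (y == b), (x == b) && (y == a) | haspair ps x y].
Proof.
rewrite /haspair !inE !xpair_eqE (andbC (y == a)).
by case: (_ && _); case: (_ && _); case: (_ \in _).
Qed.

Lemma flat_cat ps cs : flat (ps ++ cs) = flat ps ++ flat cs.
Proof. by elim: ps => //= c ps ->. Qed.

Lemma size_flat ps : size (flat ps) = 2 * size ps.
Proof. by elim: ps => //= c ps ->; lia. Qed.

Lemma mem_flat ps c : c \in ps -> (c.1 \in flat ps) /\ (c.2 \in flat ps).
Proof.
elim: ps => //= d ps IH; rewrite inE => /orP[/eqP->|/IH[]]; first by rewrite !inE !eqxx !orbT.
by rewrite !inE => -> ->; rewrite !orbT.
Qed.

Lemma flat_mem ps x : x \in flat ps -> exists y, haspair ps x y.
Proof.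
elim: ps => //= -[a b] ps IH; rewrite !inE => /or3P[/eqP->|/eqP->|/IH[y h]].
- by exists b; rewrite haspair_cons !eqxx.
- by exists a; rewrite haspair_cons !eqxx orbT.
- by exists y; rewrite haspair_cons h !orbT.
Qed.

Lemma haspair_flat ps x y : haspair ps x y -> (x \in flat ps) /\ (y \in flat ps).
Proof. by case/orP => /mem_flat[]. Qed.

Lemma partner_haspair ps x y : uniq (flat ps) -> haspair ps x y -> partner ps x = y.
Proof.
elim: ps => //= -[a b] ps IH /and3P[/=]; rewrite inE negb_or => /andP[ab anf] bnf u.
rewrite haspair_cons => /or3P[/andP[/eqP-> /eqP->]|/andP[/eqP-> /eqP->]|h].
- by rewrite eqxx.
- by rewrite eq_sym (negbTE ab) eqxx.
- have [xf yf] := haspair_flat h; rewrite -(IH u h).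
  by rewrite (negbTE (memPn anf _ xf)) (negbTE (memPn bnf _ xf)).
Qed.

Lemma haspair_inj ps x y z : uniq (flat ps) -> haspair ps x y -> haspair ps x z -> y = z.
Proof. by move=> u /(partner_haspair u) <- /(partner_haspair u). Qed.

Lemma haspair_irr ps x : uniq (flat ps) -> haspair ps x x = false.
Proof.
elim: ps => //= -[a b] ps IH /and3P[/=]; rewrite inE negb_or => /andP[ab _] _ u.
rewrite haspair_cons IH // orbF andbC orbb.
by apply/negP => /andP[/eqP E1 /eqP E2]; rewrite -E1 -E2 eqxx in ab.
Qed.

Lemma uniq_pair_mem ps a b : uniq (flat ps) -> (a, b) \in ps -> (b, a) \in ps -> False.
Proof.
elim: ps => //= -[c d] ps IH /and3P[/=]; rewrite inE negb_or => /andP[cd cf] df u.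
rewrite !inE !xpair_eqE => /orP[/andP[/eqP-> /eqP->]|h1] /orP[/andP[/eqP E1 /eqP E2]|h2].
- by rewrite E1 eqxx in cd.
- by case: (mem_flat h2) => /=; rewrite (negbTE df).
- by case: (mem_flat h1) => /=; rewrite E2 (negbTE df).
- exact: IH.
Qed.

(** A pair of a matching is determined by any one of its elements, in particular by the least; only
    the orientation stays open. *)
Lemma haspair_min ps a b c d : uniq (flat ps) -> haspair ps a b -> haspair ps c d ->
  minn a b = minn c d -> (a = c /\ b = d) \/ (a = d /\ b = c).
Proof.
move=> u hab hcd.
have hba : haspair ps b a by rewrite haspairC.
have hdc : haspair ps d c by rewrite haspairC.
rewrite /minn; case: ifP => _; case: ifP => _ E; subst.
- by left; split=> //; apply: (haspair_inj u hab hcd).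
- by right; split=> //; apply: (haspair_inj u hab hdc).
- by right; split=> //; apply: (haspair_inj u hba hcd).
- by left; split=> //; apply: (haspair_inj u hba hdc).
Qed.

Lemma flat_rem ps c : c \in ps -> perm_eq (flat ps) ([:: c.1; c.2] ++ flat (rem c ps)).
Proof.
elim: ps => //= d ps IH; rewrite inE eq_sym; case: eqVneq => [-> //|ne /= /IH p].
apply: (@perm_trans _ ([:: d.1; d.2] ++ [:: c.1; c.2] ++ flat (rem c ps))).
  by rewrite -[_ :: _ :: flat ps]/([:: d.1; d.2] ++ flat ps) perm_cat2l.
by rewrite perm_catCA.
Qed.

Lemma haspair_rem ps c x y : c \in ps -> haspair ps x y = haspair (c :: rem c ps) x y.
Proof. by move=> cp; rewrite /haspair !(perm_mem (perm_to_rem cp)). Qed.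

(** * Cherries and the choice of the next one *)

Lemma pick_cherryP cs :
  match pick_cherry cs with
  | None => cs = [::]
  | Some c => c \in cs /\ forall d, d \in cs -> minn c.1 c.2 <= minn d.1 d.2
  end.
Proof.
elim: cs => //= c cs; rewrite -/(pick_cherry cs).
case: (pick_cherry cs) => [d|->]; last first.
  by split=> [|d]; rewrite inE // => /eqP->.
case=> dcs dmin; case: ifP => lt; split.
- by rewrite mem_head.
- move=> e; rewrite inE => /orP[/eqP-> //|/dmin]; exact/leq_trans/ltnW.
- by rewrite inE dcs orbT.
- by move=> e; rewrite inE => /orP[/eqP->|/dmin //]; rewrite leqNgt lt.
Qed.

Lemma pick_cherry_unique cs a b : uniq (flat cs) -> (a, b) \in cs ->
  (forall d, d \in cs -> minn a b <= minn d.1 d.2) -> pick_cherry cs = Some (a, b).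
Proof.
move=> u ab abmin; have := pick_cherryP cs.
case: (pick_cherry cs) => [[c d]|E]; last by rewrite E in ab.
case=> cd cdmin; have E : minn a b = minn c d.
  by apply/eqP; rewrite eqn_leq (abmin _ cd) (cdmin _ ab).
have hab : haspair cs a b by rewrite /haspair ab.
have hcd : haspair cs c d by rewrite /haspair cd.
have [[-> ->] //|[E1 E2]] := haspair_min u hab hcd E.
by case: (uniq_pair_mem u cd); rewrite -E1 -E2.
Qed.

Lemma flat_cherries_subseq t : subseq (flat (cherries t)) (leaves t).
Proof.
elim: t => [a|l IHl r IHr] //.
have H : subseq (flat (cherries l ++ cherries r)) (leaves l ++ leaves r).
  by rewrite flat_cat cat_subseq.
by case: l r {IHl IHr} H => [a|ll lr] [b|rl rr] //= _; rewrite !eqxx.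
Qed.

Lemma cherry_leaves t c : c \in cherries t -> (c.1 \in leaves t) /\ (c.2 \in leaves t).
Proof.
by case/mem_flat => c1 c2; split; apply: (mem_subseq (flat_cherries_subseq t)).
Qed.

Lemma uniq_cherries t : uniq (leaves t) -> uniq (flat (cherries t)).
Proof. exact/subseq_uniq/flat_cherries_subseq. Qed.

Lemma cherries_node l r : is_leaf l && is_leaf r = false ->
  cherries (BNode l r) = cherries l ++ cherries r.
Proof. by case: l => [?|??]; case: r => [?|??]. Qed.

Lemma cherries_nil t : cherries t = [::] -> is_leaf t.
Proof.
elim: t => // l IHl r IHr; case E: (is_leaf l && is_leaf r).
  by case: l r E {IHl IHr} => [a|//] [b|//].
rewrite cherries_node //; case: (cherries l) IHl => // /(_ erefl) ll.
by case: (cherries r) IHr => // /(_ erefl) rl; rewrite ll rl in E.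
Qed.

(** Each leaf lies in a cherry, or is single, or is the whole tree. *)
Lemma size_leaves_nsingle t :
  size (leaves t) = size (flat (cherries t)) + nsingle t + is_leaf t.
Proof.
elim: t => // l IHl r IHr.
have -> : leaves (BNode l r) = leaves l ++ leaves r by [].
rewrite size_cat IHl IHr.
by case: l r {IHl IHr} => [a|ll lr] [b|rl rr] //=; rewrite ?flat_cat ?size_cat ?cats0 /=; lia.
Qed.

Lemma leaves_neq0 t : 0 < size (leaves t).
Proof. by elim: t => //= l IHl r _; rewrite size_cat addn_gt0 IHl. Qed.

Lemma is_leaf_size t : is_leaf t = (size (leaves t) == 1).
Proof.
by case: t => //= l r; rewrite size_cat; have := leaves_neq0 l; have := leaves_neq0 r; lia.
Qed.

(** * Collapsing a cherry and expanding a leaf *)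

Fixpoint expand (m a b : nat) t : btree :=
  match t with
  | BLeaf x => if x == m then BNode (BLeaf a) (BLeaf b) else BLeaf x
  | BNode l r => BNode (expand m a b l) (expand m a b r)
  end.

(** As [m] is fresh, every leaf [m] that gets expanded comes from the collapse. *)
Lemma expand_collapse m a b t : m \notin leaves t -> expand m a b (collapse a b m t) = t.
Proof.
elim: t => [x|l IHl r IHr] /=.
  by rewrite inE eq_sym => /negbTE->.
rewrite mem_cat negb_or => /andP[ml mr].
have := IHl ml; have := IHr mr.
case: l {IHl} ml => [x|ll lr] ml; case: r {IHr} mr => [y|rl rr] mr Er El //.
- case: ifP => [/andP[/eqP-> /eqP->]|_] /=; first by rewrite eqxx.
  by move: ml mr; rewrite !inE ![m == _]eq_sym => /negbTE-> /negbTE->.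
- by rewrite -[in RHS]El -[in RHS]Er.
- by rewrite -[in RHS]El -[in RHS]Er.
- by rewrite -[in RHS]El -[in RHS]Er.
Qed.

(** As [a] is absent from [u], every cherry [(a, b)] that gets collapsed comes from the
    expansion. *)
Lemma collapse_expand m a b u : a \notin leaves u -> collapse a b m (expand m a b u) = u.
Proof.
elim: u => [x|l IHl r IHr] /=.
  by case: eqP => //= ->; rewrite !eqxx.
rewrite mem_cat negb_or => /andP[al ar].
have := IHl al; have := IHr ar.
case: l {IHl} al => [x|ll lr] al; case: r {IHr} ar => [y|rl rr] ar //=; last by move=> -> ->.
- case: eqP => [->|_]; case: eqP => [->|_] //=; rewrite ?eqxx //.
  by move: al; rewrite inE eq_sym => /negbTE->.
- by move=> -> _; case: eqP => [->|_] /=; rewrite ?eqxx.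
- by move=> _ ->; case: eqP => [->|_] /=; rewrite ?eqxx.
Qed.

Lemma expand_notin m a b u : m \notin leaves u -> expand m a b u = u.
Proof.
elim: u => [x|l IHl r IHr] /=; first by rewrite inE eq_sym => /negbTE->.
by rewrite mem_cat negb_or => /andP[/IHl-> /IHr->].
Qed.

(** The leaf [m] is traded for [a] and [b]; adding [m] on the left avoids a removal on the right. *)
Lemma leaves_expand m a b u : uniq (leaves u) -> m \in leaves u ->
  perm_eq (m :: leaves (expand m a b u)) [:: a, b & leaves u].
Proof.
elim: u => [x|l IHl r IHr] /=.
  rewrite inE => _ /eqP<-; rewrite eqxx /=.
  by rewrite -[[:: m; a; b]]/([:: m] ++ [:: a; b]) perm_catC.
rewrite cat_uniq mem_cat => /and3P[ul dis ur] /orP[ml|mr].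
  have mr : m \notin leaves r by apply: contra dis => mr; apply/hasP; exists m.
  by rewrite (expand_notin _ _ mr) -!cat_cons perm_cat2r IHl.
have ml : m \notin leaves l by apply: contra dis => ml; apply/hasP; exists m.
rewrite (expand_notin _ _ ml) -cat_cons -cat1s -catA perm_catCA cat1s.
apply: (@perm_trans _ (leaves l ++ [:: a, b & leaves r])); first by rewrite perm_cat2l IHr.
by rewrite -[[:: a, b & leaves r]]/([:: a; b] ++ leaves r) perm_catCA.
Qed.

Lemma is_leaf_expand m a b u : is_leaf (expand m a b u) = is_leaf u && (leaves u != [:: m]).
Proof.
case: u => [x|l r] //=; rewrite eqseq_cons andbT.
by case: eqP.
Qed.

(** Expansion creates the cherry [(a, b)], destroys the cherry containing [m], if any, since one of
    its leaves becomes internal, and keeps all others. *)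
Lemma cherries_expand m a b u c : uniq (leaves u) -> m \in leaves u ->
  (c \in cherries (expand m a b u)) =
  (c == (a, b)) || [&& c \in cherries u, c.1 != m & c.2 != m].
Proof.
elim: u => [x|l IHl r IHr]; first by rewrite inE => _ /eqP <- /=; rewrite eqxx orbF inE.
have H v : m \notin leaves v -> (c \in cherries v) = [&& c \in cherries v, c.1 != m & c.2 != m].
  move=> mv; case cv: (c \in cherries v) => //=; case: (cherry_leaves cv) => c1 c2.
  by rewrite !(memPn mv).
rewrite [leaves _]/= cat_uniq mem_cat => /and3P[ul dis ur] mlr.
case E: (is_leaf l && is_leaf r).
  case: l r E mlr dis {IHl IHr ul ur} => [x|//] [y|//] _ mlr; rewrite /= !inE orbF => xy.
  case: c {H} => c d; rewrite /= !xpair_eqE; move: mlr xy; rewrite !inE ![m == _]eq_sym.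
  case: (x =P m) => [->|xm] /=; case: (y =P m) => [->|ym] //= _; rewrite ?eqxx // => _;
    rewrite ?inE ?xpair_eqE ?orbF.
  - by case: (c =P m) => [->|cm] /=; rewrite ?andbF ?orbF.
  - by case: (d =P m) => [->|cm] /=; rewrite ?andbF ?orbF.
rewrite [expand _ _ _ _]/= !cherries_node // ?mem_cat; last first.
  rewrite !is_leaf_expand; case: (is_leaf l) E => //= ->; by rewrite andbF.
case/orP: mlr => [ml|mr].
  have mr : m \notin leaves r by apply: contra dis => mr; apply/hasP; exists m.
  by rewrite IHl // (expand_notin _ _ mr) andb_orl -(H r mr) orbA.
have ml : m \notin leaves l by apply: contra dis => ml; apply/hasP; exists m.
by rewrite IHr // (expand_notin _ _ ml) andb_orl -(H l ml) orbCA.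
Qed.

Lemma collapse_node a b m l r : is_leaf l && is_leaf r = false ->
  collapse a b m (BNode l r) = BNode (collapse a b m l) (collapse a b m r).
Proof. by case: l => [?|??]; case: r => [?|??]. Qed.

Lemma collapse_notin a b m t : a \notin leaves t -> collapse a b m t = t.
Proof.
elim: t => // l IHl r IHr; rewrite [leaves _]/= mem_cat negb_or => /andP[al ar].
case E: (is_leaf l && is_leaf r); last by rewrite collapse_node // IHl // IHr.
case: l r E al {IHl IHr ar} => [x|//] [y|//] _ /=.
by rewrite inE eq_sym => /negbTE->.
Qed.

Lemma leaves_collapse a b m t : uniq (leaves t) -> (a, b) \in cherries t ->
  perm_eq (m :: leaves t) [:: a, b & leaves (collapse a b m t)].
Proof.
elim: t => // l IHl r IHr.
case E: (is_leaf l && is_leaf r).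
  case: l r E {IHl IHr} => [x|//] [y|//] _ /= _.
  rewrite inE xpair_eqE => /andP[/eqP<- /eqP<-]; rewrite !eqxx /=.
  by rewrite -[[:: m; a; b]]/([:: m] ++ [:: a; b]) perm_catC.
rewrite collapse_node // cherries_node // [leaves _]/= cat_uniq mem_cat.
case/and3P=> ul dis ur /orP[abl|abr].
  have [al _] := cherry_leaves abl.
  have ar : a \notin leaves r by apply: contra dis => ar; apply/hasP; exists a.
  by rewrite (collapse_notin _ _ ar) /= -!cat_cons perm_cat2r IHl.
have [ar _] := cherry_leaves abr.
have al : a \notin leaves l by apply: contra dis => al; apply/hasP; exists a.
rewrite (collapse_notin _ _ al) /= -cat_cons -cat1s -catA perm_catCA cat1s.
apply: (@perm_trans _ (leaves l ++ [:: a, b & leaves (collapse a b m r)])).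
  by rewrite perm_cat2l IHr.
by rewrite -[[:: a, b & _]]/([:: a; b] ++ leaves (collapse a b m r)) perm_catCA.
Qed.

(** * One labelling step, and the pairs it produces *)

Lemma psi_leaf f m x : psi_pairs f m (BLeaf x) = [::].
Proof. by case: f. Qed.

(** The special case of a root with two leaves follows the general rule too: collapsing leaves a
    single leaf, which yields no pairs. *)
Lemma psi_cons f m t a b : pick_cherry (cherries t) = Some (a, b) ->
  psi_pairs f.+1 m t = (a, b) :: psi_pairs f m.+1 (collapse a b m t).
Proof.
case: t => [//|l r]; case E: (is_leaf l && is_leaf r).
  by case: l r E => [x|//] [y|//] _ /= [<- <-]; rewrite !eqxx psi_leaf.
by case: l E => [x|ll lr]; case: r => [y|rl rr] // _ H; rewrite /psi_pairs -/psi_pairs H.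
Qed.

(** The tree before the step is given as an expansion of the tree [u] after it, so that what
    induction yields for [u] is carried back by the lemmas on [expand]. *)
Variant psi_step_spec f m t : Prop :=
  PsiStep a b u of t = expand m a b u
    & psi_pairs f.+1 m t = (a, b) :: psi_pairs f m.+1 u
    & perm_eq (m :: leaves t) [:: a, b & leaves u]
    & uniq (leaves u) & m \in leaves u & all (fun x => x < m.+1) (leaves u)
    & (a, b) \in cherries t
    & (forall d, d \in cherries t -> minn a b <= minn d.1 d.2).

Lemma psi_step f m t : uniq (leaves t) -> all (fun x => x < m) (leaves t) ->
  is_leaf t = false -> psi_step_spec f m t.
Proof.
move=> ut ltm nl; have := pick_cherryP (cherries t).
case E: (pick_cherry (cherries t)) => [[a b]|]; last by move/cherries_nil; rewrite nl.
case=> ab abmin; have mt : m \notin leaves t.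
  by apply/negP => /(allP ltm); rewrite ltnn.
have P := leaves_collapse m ut ab.
have [at' bt] := cherry_leaves ab.
apply: (@PsiStep f m t a b (collapse a b m t)) => //.
- by rewrite expand_collapse.
- exact: psi_cons.
- have : uniq (m :: leaves t) by rewrite /= mt ut.
  by rewrite (perm_uniq P) => /and3P[].
- have := perm_mem P m; rewrite !inE eqxx /=.
  have /negbTE-> : m != a by rewrite neq_ltn (allP ltm _ at') orbT.
  by have /negbTE-> : m != b by rewrite neq_ltn (allP ltm _ bt) orbT.
- apply/allP => x xu; have := perm_mem P x; rewrite !inE xu !orbT.
  by case/orP => [/eqP->|/(allP ltm)]; rewrite ltnS // => /ltnW.
Qed.

Lemma size_psi_step m t a b u : perm_eq (m :: leaves t) [:: a, b & leaves u] ->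
  size (leaves t) = (size (leaves u)).+1.
Proof. by move/perm_size => /= [->]. Qed.

(** By induction the recorded pairs below [m] are [(a, b)] and the cherries of [u] avoiding [m],
    which are the cherries of [t] by [cherries_expand]. *)
Lemma psi_cherries f m t c : uniq (leaves t) -> all (fun x => x < m) (leaves t) ->
  size (leaves t) <= f.+1 -> c.1 < m -> c.2 < m ->
  (c \in psi_pairs f m t) = (c \in cherries t).
Proof.
elim: f m t => [|f IH] m t ut ltm sz c1 c2.
  have: is_leaf t by rewrite is_leaf_size; have := leaves_neq0 t; lia.
  by case: t {ut ltm sz}.
case E: (is_leaf t); first by case: t E {ut ltm sz} => // x; rewrite psi_leaf.
have [a b u tE -> P uu mu ltu _ _] := psi_step f ut ltm E.
rewrite inE IH //; try by rewrite ?leqW //.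
  by rewrite tE cherries_expand // !neq_ltn c1 c2 !andbT.
by move: sz; rewrite (size_psi_step P).
Qed.

(** Every step trades two labels for a new one. The last step pairs the children of the root, whose
    own label never enters a pair; hence two new labels fewer than leaves. *)
Lemma psi_flat f m t : uniq (leaves t) -> all (fun x => x < m) (leaves t) ->
  size (leaves t) <= f.+1 -> is_leaf t = false ->
  perm_eq (flat (psi_pairs f m t)) (leaves t ++ iota m (size (leaves t) - 2)).
Proof.
elim: f m t => [|f IH] m t ut ltm sz nl.
  by move: nl; rewrite is_leaf_size; have := leaves_neq0 t; lia.
have [a b u tE -> P uu mu ltu _ _] := psi_step f ut ltm nl.
have szt := size_psi_step P.
case ul: (is_leaf u).
  case: u ul mu szt P {tE uu ltu} => // x _; rewrite inE => /eqP<- -> P.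
  rewrite psi_leaf cats0 /= -(perm_cons m) perm_sym (perm_trans P) //.
  by rewrite -[[:: m; a; b]]/([:: m] ++ [:: a; b]) perm_sym perm_catC.
have szu : 1 < size (leaves u).
  by move: ul; rewrite is_leaf_size; have := leaves_neq0 u; lia.
have IHu : perm_eq (flat (psi_pairs f m.+1 u)) (leaves u ++ iota m.+1 (size (leaves u) - 2)).
  by apply: IH => //; rewrite szt in sz.
rewrite szt; have -> : (size (leaves u)).+1 - 2 = (size (leaves u) - 2).+1 by lia.
apply: (@perm_trans _ ([:: a, b & leaves u] ++ iota m.+1 (size (leaves u) - 2))).
  by rewrite /= !perm_cons.
apply: (@perm_trans _ ((m :: leaves t) ++ iota m.+1 (size (leaves u) - 2))).
  by rewrite perm_cat2r perm_sym.
by rewrite /= -cat1s -[m :: iota _ _]cat1s perm_catCA.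
Qed.

Lemma psi_uniq f m t : uniq (leaves t) -> all (fun x => x < m) (leaves t) ->
  size (leaves t) <= f.+1 -> uniq (flat (psi_pairs f m t)).
Proof.
move=> ut ltm sz; case nl: (is_leaf t); first by case: t nl {ut ltm sz} => // x; rewrite psi_leaf.
rewrite (perm_uniq (psi_flat ut ltm sz nl)) cat_uniq ut iota_uniq andbT /=.
by apply/hasPn => x; rewrite mem_iota => /andP[mx _]; apply/negP => /(allP ltm); rewrite ltnNge mx.
Qed.

(* The weight of the new label m is that of the least leaf below it, so that
   canonicity with respect to a weight is preserved by collapsing a cherry. *)
Definition reweight (m c : nat) (w : nat -> nat) (x : nat) := if x == m then c else w x.

Lemma tmin_expand w m a b u : w a < w b ->
  tmin (relabel w (expand m a b u)) = tmin (relabel (reweight m (w a) w) u).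
Proof.
move=> ab; elim: u => [x|l IHl r IHr] /=; last by rewrite IHl IHr.
by rewrite /reweight; case: eqP => //= _; apply/minn_idPl/ltnW.
Qed.

Lemma canonical_expand w m a b u : w a < w b ->
  canonical (relabel w (expand m a b u)) = canonical (relabel (reweight m (w a) w) u).
Proof.
move=> ab; elim: u => [x|l IHl r IHr] /=; last by rewrite IHl IHr !tmin_expand.
by case: eqP => //= _.
Qed.

(** * Recovering a tree from its pairs *)

Lemma cherry_canonical w t a b : canonical (relabel w t) -> (a, b) \in cherries t -> w a < w b.
Proof.
elim: t => // l IHl r IHr /= /and3P[cl cr lt].
case E: (is_leaf l && is_leaf r).
  case: l r E lt {IHl IHr cl cr} => [x|//] [y|//] _ /= xy.
  by rewrite inE xpair_eqE => /andP[/eqP-> /eqP->].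
by rewrite -/(cherries (BNode l r)) cherries_node // mem_cat => /orP[/(IHl cl)|/(IHr cr)].
Qed.

(** In a matching, the pairs other than [{a, b}] are those whose first entry is neither [a] nor [b],
    a condition independent of the list. *)
Lemma haspair_behead a b ps ps' : uniq (flat ((a, b) :: ps)) -> uniq (flat ((a, b) :: ps')) ->
  haspair ((a, b) :: ps) =2 haspair ((a, b) :: ps') -> haspair ps =2 haspair ps'.
Proof.
move=> u u' H x y.
have aux qs : uniq (flat ((a, b) :: qs)) ->
    haspair qs x y = haspair ((a, b) :: qs) x y && (x != a) && (x != b).
  rewrite /= inE negb_or => /and3P[/andP[_ aq] bq _]; rewrite haspair_cons.
  case h: (haspair qs x y).
    by have [xq _] := haspair_flat h; rewrite !orbT (memPn aq) // (memPn bq).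
  by rewrite orbF; case: (x == a) => //=; case: (x == b) => //=; rewrite ?andbF.
by rewrite (aux _ u) (aux _ u') H.
Qed.

Lemma psi_inj f m w t t' :
  uniq (leaves t) -> all (fun x => x < m) (leaves t) ->
  size (leaves t) <= f.+1 -> perm_eq (leaves t) (leaves t') ->
  canonical (relabel w t) -> canonical (relabel w t') ->
  haspair (psi_pairs f m t) =2 haspair (psi_pairs f m t') -> t = t'.
Proof.
elim: f m w t t' => [|f IH] m w t t' ut ltm sz pt ct ct' H.
  have E : is_leaf t by rewrite is_leaf_size; have := leaves_neq0 t; lia.
  have : is_leaf t' by move: E; rewrite !is_leaf_size -(perm_size pt).
  case: t t' pt E {ut ltm sz ct ct' H} => [x|//] [y|//] /perm_mem/(_ x).
  by rewrite !inE eqxx => /esym/eqP->.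
case E: (is_leaf t).
  have : is_leaf t' by move: E; rewrite !is_leaf_size -(perm_size pt).
  case: t t' pt E {ut ltm sz ct ct' H} => [x|//] [y|//] /perm_mem/(_ x).
  by rewrite !inE eqxx => /esym/eqP->.
have ut' : uniq (leaves t') by rewrite -(perm_uniq pt).
have ltm' : all (fun x => x < m) (leaves t') by rewrite -(perm_all _ pt).
have E' : is_leaf t' = false by move: E; rewrite !is_leaf_size -(perm_size pt).
have sz' : size (leaves t') <= f.+2 by rewrite -(perm_size pt).
have U := psi_uniq ut ltm sz; have U' := psi_uniq ut' ltm' sz'.
have CH := psi_cherries ut ltm sz; have CH' := psi_cherries ut' ltm' sz'.
have [a b u tE psE P uu mu ltu ab abmin] := psi_step f ut ltm E.
have [a' b' u' tE' psE' P' uu' mu' ltu' ab' abmin'] := psi_step f ut' ltm' E'.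
have [/(allP ltm) am /(allP ltm) bm] := cherry_leaves ab.
have [/(allP ltm') am' /(allP ltm') bm'] := cherry_leaves ab'.
have hab : haspair (psi_pairs f.+1 m t) a b by rewrite psE haspair_cons !eqxx.
have hab' : haspair (psi_pairs f.+1 m t') a' b' by rewrite psE' haspair_cons !eqxx.
have hab2 : haspair (psi_pairs f.+1 m t) a' b' by rewrite H.
have wab := cherry_canonical ct ab; have wab' := cherry_canonical ct' ab'.
(* The pair picked in [t'] is a low pair of the common matching, hence a cherry of [t] up to
   orientation. *)
have le1 : minn a b <= minn a' b'.
  by case/orP: hab2; rewrite CH // => /abmin //=; rewrite (minnC b').
have le2 : minn a' b' <= minn a b.
  by move: hab; rewrite H => /orP[]; rewrite CH' // => /abmin' //=; rewrite (minnC b).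
have [|[Ea Eb]|[Ea Eb]] := haspair_min U hab hab2; first by apply/eqP; rewrite eqn_leq le1.
  subst a' b'; rewrite tE tE'; congr expand.
  apply: (IH m.+1 (reweight m (w a) w)) => //.
  - by move: sz; rewrite (size_psi_step P).
  - rewrite -(perm_cons b) -(perm_cons a); apply: perm_trans P'.
    by rewrite perm_sym; apply: perm_trans P; rewrite perm_cons perm_sym.
  - by rewrite -(canonical_expand _ _ wab) -tE.
  - by rewrite -(canonical_expand _ _ wab) -tE'.
  - by apply: (haspair_behead (a := a) (b := b)); rewrite -?psE -?psE'.
(* Opposite orientations contradict canonicity with respect to the same weight. *)
by move: wab wab'; rewrite Ea Eb => /ltn_trans/[apply]; rewrite ltnn.
Qed.

(* There are size S - 1 pairs and only size S - 2 labels >= m. *)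
Lemma exists_low_pair m S ps : 1 < size S -> all (fun x => x < m) S ->
  perm_eq (flat ps) (S ++ iota m (size S - 2)) ->
  exists2 c, c \in ps & (c.1 < m) && (c.2 < m).
Proof.
move=> szS ltm P; apply/hasP; apply: contraT => /hasPn nolow.
have szp : 2 * size ps = size S + (size S - 2).
  by rewrite -size_flat (perm_size P) size_cat size_iota.
have cnt : count (fun x => m <= x) (flat ps) = size S - 2.
  move/permP: P => ->; rewrite count_cat (eq_in_count (a2 := pred0)); last first.
    by move=> x /(allP ltm) /= xm; rewrite leqNgt xm.
  rewrite count_pred0 add0n (eq_in_count (a2 := predT)) ?count_predT ?size_iota //.
  by move=> x; rewrite mem_iota => /andP[->].
have : size ps <= count (fun x => m <= x) (flat ps).
  elim: ps nolow {P szp cnt} => //= c ps IH nolow.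
  have := nolow c (mem_head _ _); rewrite negb_and -!leqNgt.
  have /IH : forall x, x \in ps -> ~~ ((x.1 < m) && (x.2 < m)).
    by move=> x xps; apply: nolow; rewrite inE xps orbT.
  by case: (m <= c.1); case: (m <= c.2) => //=; lia.
lia.
Qed.

(** The low pair with the least element becomes the first cherry, and induction applies with [m] in
    place of its two labels. A singleton [S] is stated apart: the truncated [size S - 2] would
    otherwise ask for pairs covering one label. *)
Lemma psi_surj f m S ps w : uniq S -> all (fun x => x < m) S ->
  0 < size S <= f.+1 -> {in S &, injective w} ->
  (if size S == 1 then ps = [::] else perm_eq (flat ps) (S ++ iota m (size S - 2))) ->
  exists t, [/\ perm_eq (leaves t) S, canonical (relabel w t) &
                haspair (psi_pairs f m t) =2 haspair ps].
Proof.
elim: f m S ps w => [|f IH] m S ps w uS ltm /andP[S0 szS] winj;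
  (case: ifP => [S1 ->|S1 P];
    [by case: S S1 {uS ltm S0 szS winj} => [|x [|y S]] // _; exists (BLeaf x); rewrite psi_leaf|]).
  by move: S1 S0 szS; case: (size S) => [|[|k]].
have S2 : 1 < size S by move: S1 S0; case: (size S) => [|[|k]].
have [c0 c0ps /andP[c01 c02]] := exists_low_pair S2 ltm P.
pose cs := [seq c <- ps | (c.1 < m) && (c.2 < m)].
have := pick_cherryP cs; case: (pick_cherry cs) => [|E]; last first.
  by have : c0 \in cs; [rewrite mem_filter c01 c02 | rewrite E].
move=> [c d] [] /=; rewrite mem_filter /= => /andP[/andP[cm dm] cdps] cdmin.
have Ups : uniq (flat ps).
  rewrite (perm_uniq P) cat_uniq uS iota_uniq andbT /=; apply/hasPn => x.
  by rewrite mem_iota => /andP[mx _]; apply/negP => /(allP ltm); rewrite ltnNge mx.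
have inS x : x < m -> x \in flat ps -> x \in S.
  by move=> xm; rewrite (perm_mem P) mem_cat mem_iota [m <= x]leqNgt xm /= orbF.
have [cf df] := mem_flat cdps.
have cS : c \in S by apply: inS; rewrite ?cm.
have dS : d \in S by apply: inS; rewrite ?dm.
have cd : c != d.
  by apply/negP => /eqP E; have := haspair_irr c Ups; rewrite /haspair {2}E cdps.
(* The pair is oriented by weight, as canonicity of the cherry requires. *)
have [a [b [aS bS abE wab]]] : exists a b, [/\ a \in S, b \in S,
    (a, b) = (c, d) \/ (a, b) = (d, c) & w a < w b].
  case: (ltngtP (w c) (w d)) => [lt|lt|E].
  - by exists c, d; split=> //; left.
  - by exists d, c; split=> //; right.
  - by case/negP: cd; apply/eqP/winj.
pose qs := rem (c, d) ps.
have hps : haspair ps =2 haspair ((a, b) :: qs).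
  move=> x y; rewrite (haspair_rem _ _ cdps) -/qs !haspair_cons.
  by case: abE => -[-> ->] //; rewrite orbCA.
have pflat : perm_eq (flat ps) [:: a, b & flat qs].
  apply: (perm_trans (flat_rem cdps)); rewrite -/qs /=.
  case: abE => -[-> ->] //.
  by rewrite -cat1s -[d :: c :: _]cat1s -[c :: flat _]cat1s -[d :: flat _]cat1s perm_catCA.
have abmin x y : haspair ps x y -> x < m -> y < m -> minn a b <= minn x y.
  have -> : minn a b = minn c d by case: abE => -[-> ->] //; rewrite minnC.
  move=> h xm ym; case/orP: h => h.
    by apply: (cdmin (x, y)); rewrite mem_filter /= xm ym.
  by rewrite (minnC x); apply: (cdmin (y, x)); rewrite mem_filter /= xm ym.
have ab : a != b by apply: contraTneq wab => ->; rewrite ltnn.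
have mS : m \notin S by apply/negP => /(allP ltm); rewrite ltnn.
pose S' := m :: rem b (rem a S).
have bS' : b \in rem a S by rewrite mem_rem_uniq // inE eq_sym ab.
have PS : perm_eq S [:: a, b & rem b (rem a S)].
  by apply: (perm_trans (perm_to_rem aS)); rewrite perm_cons perm_to_rem.
have szS' : size S = (size S').+1 by rewrite (perm_size PS).
have sub x : x \in rem b (rem a S) -> x \in S.
  by rewrite (perm_mem PS) !inE => ->; rewrite !orbT.
have uSS : uniq [:: a, b & rem b (rem a S)] by rewrite -(perm_uniq PS).
have [u [pu cu hu]] : exists u, [/\ perm_eq (leaves u) S',
    canonical (relabel (reweight m (w a) w) u) & haspair (psi_pairs f m.+1 u) =2 haspair qs].
  apply: IH.
  - by rewrite /= !rem_uniq // andbT; apply: contra mS => /sub.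
  - rewrite /= ltnSn /=; apply/allP => x /sub/(allP ltm); exact: leqW.
  - by move: szS; rewrite szS'.
  (* The new weight stays injective: [m] inherits the weight of [a], and [a] has left the label
     set. *)
  - have nem x : x \in S -> (x == m) = false by move=> xS; apply: contraNF mS => /eqP<-.
    have nea x : x \in rem b (rem a S) -> w x <> w a.
      move=> xS E; move: (xS); rewrite (winj _ _ (sub _ xS) aS E) => aS'.
      by move: uSS; rewrite /= inE negb_or aS' andbF.
    move=> x y; rewrite !inE /reweight => /orP[/eqP->|xS] /orP[/eqP->|yS] //; rewrite ?eqxx.
    + by rewrite nem ?sub // => /esym/nea; case.
    + by rewrite nem ?sub // => /nea; case.
    + by rewrite !nem ?sub // => E; apply: winj => //; apply: sub.
  - have P1 : perm_eq [:: a, b & flat qs] ([:: a, b & rem b (rem a S)] ++ iota m (size S - 2)).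
      rewrite perm_sym in pflat; apply: (perm_trans pflat); apply: (perm_trans P).
      by rewrite perm_cat2r.
    rewrite /= !perm_cons in P1.
    case: ifP => S'1.
      have S2' : size S - 2 = 0 by rewrite szS' (eqP S'1).
      have S3' : rem b (rem a S) = [::] by apply: size0nil; move/eqP: S'1 => [].
      have := perm_size P1; rewrite S2' S3' size_flat /=.
      by case: (qs).
    rewrite (perm_trans P1) // /S' /=.
    have -> : size S - 2 = (size S' - 2).+1.
      by rewrite szS'; move: S'1 => /=; case: (size _) => [|k] // _; rewrite !subSS !subn0.
    by rewrite /= -[m :: iota _ _]cat1s perm_sym -cat1s perm_catCA.
have uu : uniq (leaves u).
  rewrite (perm_uniq pu) /= !rem_uniq // andbT.
  by apply: contra mS => /sub.
have mu : m \in leaves u by rewrite (perm_mem pu) mem_head.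
have ltu : all (fun x => x < m.+1) (leaves u).
  rewrite (perm_all _ pu) /= ltnSn /=; apply/allP => x /sub/(allP ltm); exact: leqW.
have szu : size (leaves u) <= f.+1 by rewrite (perm_size pu) -ltnS -szS'.
pose t := expand m a b u.
have pt : perm_eq (leaves t) S.
  rewrite -(perm_cons m) (perm_trans (leaves_expand _ _ uu mu)) //.
  apply: (@perm_trans _ [:: a, b & S']); first by rewrite !perm_cons.
  rewrite perm_sym; apply: (@perm_trans _ (m :: [:: a, b & rem b (rem a S)])).
    by rewrite perm_cons.
  by rewrite -[[:: a, b & S']]/([:: a; b] ++ [:: m] ++ rem b (rem a S)) perm_sym perm_catCA.
have ut : uniq (leaves t) by rewrite (perm_uniq pt).
have au : a \notin leaves u.
  rewrite (perm_mem pu) inE negb_or; case/andP: uSS; rewrite inE negb_or => /andP[_ ->] _.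
  by rewrite andbT; apply: contraNneq mS => <-.
(* Any other cherry of [t] is a cherry of [u], thus a low pair of [ps], so its least element is no
   smaller. *)
have pick : pick_cherry (cherries t) = Some (a, b).
  apply: pick_cherry_unique.
  - exact: uniq_cherries.
  - by rewrite cherries_expand // eqxx.
  - case=> x y xyt; have [/= xt yt] := cherry_leaves xyt.
    have xm : x < m by apply: (allP ltm); rewrite -(perm_mem pt).
    have ym : y < m by apply: (allP ltm); rewrite -(perm_mem pt).
    apply: abmin => //; rewrite hps haspair_cons.
    move: xyt; rewrite cherries_expand // => /orP[/eqP[-> ->]|/andP[xyu _]].
      by rewrite !eqxx.
    by rewrite -hu /haspair psi_cherries ?xyu ?orbT //= ltnW.
have psE := psi_cons f m pick.
exists t; split; [by [] | by rewrite canonical_expand |].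
change (haspair (psi_pairs f.+1 m t) =2 haspair ps) => x y.
by rewrite psE collapse_expand // hps !haspair_cons hu.
Qed.

(** * From lists of pairs to involutions of ['I_(2 * n - 2)] *)

Lemma iota_split n : 2 <= n -> iota 1 (2 * n - 2) = iota 1 n ++ iota n.+1 (n - 2).
Proof. by move=> n2; rewrite -[n.+1]/(1 + n) -iotaD; congr iota; lia. Qed.

Lemma relabel_id t : relabel id t = t.
Proof. exact: relabel_id_in. Qed.

Lemma flat_map (T : Type) (g h : T -> nat) (r : seq T) :
  perm_eq (flat [seq (g i, h i) | i <- r]) (map g r ++ map h r).
Proof.
elim: r => //= i r IH; rewrite perm_cons.
apply: (@perm_trans _ (h i :: (map g r ++ map h r))); first by rewrite perm_cons.
by rewrite -cat1s -[h i :: map h r]cat1s perm_catCA.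
Qed.

Section PsiTree.
Variables (n : nat) (t : btree).
Hypotheses (n2 : 2 <= n) (tt : is_tree n t).
Let ps := psi_pairs n n.+1 t.

Let pt : perm_eq (leaves t) (iota 1 n).
Proof. by case/andP: tt. Qed.

Let ut : uniq (leaves t).
Proof. by rewrite (perm_uniq pt) iota_uniq. Qed.

Let szt : size (leaves t) = n.
Proof. by rewrite (perm_size pt) size_iota. Qed.

Let ltt : all (fun x => x < n.+1) (leaves t).
Proof. by rewrite (perm_all _ pt); apply/allP => x; rewrite mem_iota => /andP[]. Qed.

Let nl : is_leaf t = false.
Proof. by rewrite is_leaf_size szt; lia. Qed.

Lemma tree_size_fuel : size (leaves t) <= n.+1.
Proof. by rewrite szt. Qed.

Lemma tree_flat : perm_eq (flat ps) (iota 1 (2 * n - 2)).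
Proof.
rewrite iota_split //; have := psi_flat ut ltt tree_size_fuel nl.
by rewrite szt => /perm_trans; apply; rewrite perm_cat2r.
Qed.

Lemma tree_uniq_flat : uniq (flat ps).
Proof. by rewrite (perm_uniq tree_flat) iota_uniq. Qed.

(** The pairs cover exactly the labels 1 to 2n-2, so the partner is always in range and the default
    of [insubd] is never taken. *)
Lemma PsiE (i j : 'I_(2 * n - 2)) : (Psi n t i == j) = haspair ps i.+1 j.+1.
Proof.
have val_Psi (k : 'I_(2 * n - 2)) : haspair ps i.+1 k.+1 -> Psi n t i = k.
  move=> /(partner_haspair tree_uniq_flat) E; apply: val_inj.
  by rewrite /Psi ffunE -/ps E val_insubd /= ltn_ord.
apply/eqP/idP => [<-|/val_Psi //].
have : i.+1 \in flat ps by rewrite (perm_mem tree_flat) mem_iota /= add1n ltnS ltn_ord.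
case/flat_mem => y h; have [_] := haspair_flat h.
rewrite (perm_mem tree_flat) mem_iota; case: y h => // y h.
by rewrite /= add1n ltnS => yN; rewrite (val_Psi (Ordinal yN)).
Qed.

Lemma Psi_matching : is_matching (Psi n t).
Proof.
apply/forallP => i; have h : haspair ps i.+1 (Psi n t i).+1 by rewrite -PsiE.
rewrite PsiE haspairC h /=; apply: contraTneq h => ->.
by rewrite haspair_irr // tree_uniq_flat.
Qed.

(** By [psi_cherries] a label at most n has a partner at most n exactly when it lies in a cherry.
    The crossing pairs thus count the leaves outside cherries, and [size_leaves_nsingle]
    concludes. *)
Lemma Psi_cross : cross (Psi n t) = nsingle t.
Proof.
pose C := flat (cherries t).
have crossE (i : 'I_(2 * n - 2)) :
    (i < n) && (n <= Psi n t i) = (i.+1 <= n) && (i.+1 \notin C).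
  case: (ltnP i n) => //= lti.
  have h : haspair ps i.+1 (Psi n t i).+1 by rewrite -PsiE.
  rewrite leqNgt; congr (~~ _); apply/idP/idP => [ltP|].
    suff /haspair_flat[] : haspair (cherries t) i.+1 (Psi n t i).+1 by [].
    by move: h; rewrite /haspair !(psi_cherries ut ltt tree_size_fuel).
  case/flat_mem => y hy.
  have [_ yt] := haspair_flat hy.
  have yn : y < n.+1 by apply: (allP ltt); apply: (mem_subseq (flat_cherries_subseq t)).
  have h' : haspair ps i.+1 y.
    by move: hy; rewrite /haspair !(psi_cherries ut ltt tree_size_fuel).
  by move: yn; rewrite (haspair_inj tree_uniq_flat h' h).
rewrite /cross (eq_card (B := [pred i : 'I_(2 * n - 2) | (i.+1 <= n) && (i.+1 \notin C)])) //.
rewrite cardE /enum_mem size_filter -enumT.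
rewrite (eq_count (a2 := preim (fun i : 'I_(2 * n - 2) => (val i).+1)
  (fun x => (x <= n) && (x \notin C)))) // -count_map.
have -> : [seq (val i).+1 | i <- enum 'I_(2 * n - 2)] = iota 1 (2 * n - 2).
  by rewrite (map_comp S val) val_enum_ord -[1]/(1 + 0) iotaDl.
rewrite iota_split // count_cat addnC (eq_in_count (a2 := pred0)); last first.
  by move=> x; rewrite mem_iota => /andP[lt _]; rewrite leqNgt lt.
rewrite count_pred0 add0n (eq_in_count (a2 := predC (mem C))); last first.
  by move=> x; rewrite mem_iota add1n ltnS => /andP[_ ->].
move/permP: (pt) => <-.
have C1 : count (mem C) (leaves t) = size C.
  rewrite -size_filter; apply/perm_size/uniq_perm.
  - exact: filter_uniq.
  - exact: uniq_cherries.
  - move=> x; rewrite mem_filter /= andb_idr // => xC.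
    exact: (mem_subseq (flat_cherries_subseq t)).
have := count_predC (mem C) (leaves t).
by rewrite C1 [size (leaves t)]size_leaves_nsingle nl -/C addn0 => /addnI.
Qed.

End PsiTree.

Section Matching.
Variables (n : nat) (f : {ffun 'I_(2 * n - 2) -> 'I_(2 * n - 2)}).
Hypothesis mf : is_matching f.

Definition matching_pairs : seq (nat * nat) :=
  [seq ((val i).+1, (val (f i)).+1) | i <- enum [pred i : 'I_(2 * n - 2) | i < f i]].

Let fK i : f (f i) = i.
Proof. by move/forallP/(_ i): mf => /andP[/eqP]. Qed.

Let fne i : f i != i.
Proof. by move/forallP/(_ i): mf => /andP[]. Qed.

Lemma haspair_matching (i : 'I_(2 * n - 2)) : haspair matching_pairs i.+1 (f i).+1.
Proof.
rewrite /haspair; case: (ltngtP i (f i)) => [lt|lt|/val_inj E].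
- by apply/orP; left; apply/mapP; exists i; rewrite // mem_enum inE.
- by apply/orP; right; apply/mapP; exists (f i); rewrite ?fK // mem_enum inE fK.
- by have := fne i; rewrite -E eqxx.
Qed.

Lemma flat_matching : perm_eq (flat matching_pairs) (iota 1 (2 * n - 2)).
Proof.
apply: (perm_trans (flat_map _ _ _)); apply: uniq_perm; last first.
- move=> x; rewrite mem_iota mem_cat; apply/orP/idP => [[] /mapP[i _ ->]|].
  + by rewrite /= add1n ltnS ltn_ord.
  + by rewrite /= add1n ltnS ltn_ord.
  case: x => // x; rewrite /= add1n ltnS => xN; have [h1 h2] := haspair_flat (haspair_matching (Ordinal xN)).
  by move: h1; rewrite (perm_mem (flat_map _ _ _)) mem_cat => /orP.
- exact: iota_uniq.
have inj1 : injective (fun i : 'I_(2 * n - 2) => (val i).+1) by move=> i j [/val_inj].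
have inj2 : injective (fun i : 'I_(2 * n - 2) => (val (f i)).+1).
  by move=> i j [/val_inj E]; rewrite -(fK i) E fK.
rewrite cat_uniq !map_inj_uniq // enum_uniq andbT /=.
apply/hasPn => x /mapP[i]; rewrite mem_enum inE => lti ->.
apply/negP => /mapP[j]; rewrite mem_enum inE => ltj [/val_inj E].
by move: ltj; rewrite -E fK ltnNge ltnW.
Qed.

End Matching.

Theorem Psi_bij n k : 2 <= n ->
  bij_on (fun t => is_tree n t && (nsingle t == k))
         (fun f : {ffun 'I_(2 * n - 2) -> 'I_(2 * n - 2)} => is_matching f && (cross f == k))
         (Psi n).
Proof.
move=> n2; split.
- by move=> t /andP[tt /eqP <-]; rewrite Psi_matching // Psi_cross ?eqxx.
- move=> t t' /andP[tt _] /andP[tt' _] E.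
  have /andP[ct pt] := tt; have /andP[ct' pt'] := tt'.
  apply: (@psi_inj n n.+1 id); rewrite ?relabel_id ?(perm_uniq pt) ?iota_uniq //.
  - by rewrite (perm_all _ pt); apply/allP => x; rewrite mem_iota => /andP[].
  - by rewrite (perm_size pt) size_iota.
  - by rewrite (perm_trans pt) // perm_sym.
  (* [PsiE] compares pairs of ordinals only; the range bound extends the comparison to all natural
     numbers. *)
  have range t0 x y : is_tree n t0 -> haspair (psi_pairs n n.+1 t0) x y ->
      (0 < x <= 2 * n - 2) && (0 < y <= 2 * n - 2).
    move=> tt0 /haspair_flat[]; rewrite !(perm_mem (tree_flat n2 tt0)) !mem_iota.
    by rewrite !add1n !ltnS => -> ->.
  have imp t0 t1 x y : is_tree n t0 -> is_tree n t1 -> Psi n t0 = Psi n t1 ->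
      haspair (psi_pairs n n.+1 t0) x y -> haspair (psi_pairs n n.+1 t1) x y.
    move=> tt0 tt1 E01 h; have := range _ _ _ tt0 h.
    case: x y h => [|x] [|y] h //= /andP[xN yN] //.
    have := PsiE n2 tt0 (Ordinal xN) (Ordinal yN).
    by rewrite E01 (PsiE n2 tt1) /= h.
  by move=> x y; apply/idP/idP; apply: imp.
- move=> f /andP[mf /eqP <-].
  have [||||t [pt ct ht]] := @psi_surj n n.+1 (iota 1 n) (matching_pairs f) id (iota_uniq _ _).
  - by apply/allP => x; rewrite mem_iota => /andP[].
  - by rewrite size_iota leqnSn andbT ltnW.
  - by [].
  - rewrite size_iota; case: eqP => [n1|_]; first by rewrite n1 in n2.
    by rewrite -iota_split // flat_matching.
  rewrite relabel_id in ct.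
  have tt : is_tree n t by rewrite /is_tree ct pt.
  have PE : Psi n t = f.
    by apply/ffunP => i; apply/eqP; rewrite (PsiE n2 tt) ht haspair_matching.
  by exists t; rewrite tt -(Psi_cross n2 tt) PE eqxx.
Qed.

Theorem theorem4 (n k : nat) : 2 <= n ->
  bij_on (fun x : seq int * seq nat => wl_motzkin n x.1 x.2 && (hsteps x.1 == k))
         (fun t => is_tree n t && (nsingle t == k))
         (fun x => Phi x.1 x.2)
  /\ bij_on (fun t => is_tree n t && (nsingle t == k))
            (fun f : {ffun 'I_(2 * n - 2) -> 'I_(2 * n - 2)} =>
               is_matching f && (cross f == k))
            (Psi n).
Proof. by move=> n2; split; [exact: Phi_bij | exact: Psi_bij]. Qed.
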